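(* The pseudo-differential DFT operators $\Pi^0,\Pi^1,\Pi^2,\Pi^3$ defined in the context satisfy the commuting diagram property $$\nabla\Pi^0G=\Pi^1\nabla G\ \ (G\in V^0),\qquad \operatorname{curl}\Pi^1\boldsymbol G=\Pi^2\operatorname{curl}\boldsymbol G\ \ (\boldsymbol G\in V^1),\qquad \operatorname{div}\Pi^2\boldsymbol G=\Pi^3\operatorname{div}\boldsymbol G\ \ (\boldsymbol G\in V^2),$$ with domains defined as $$V^0=\mathcal C^1_{\mathrm{per},1,2,3},\quad V^1=\mathcal C^1_{\mathrm{per},2,3}\times\mathcal C^1_{\mathrm{per},1,3}\times\mathcal C^1_{\mathrm{per},1,2},\quad V^2=\mathcal C^1_{\mathrm{per},1}\times\mathcal C^1_{\mathrm{per},2}\times\mathcal C^1_{\mathrm{per},3},\quad V^3=\mathcal C^0_{\mathrm{per}}.$$ Moreover, if $\gamma_{\boldsymbol k}=1$ (for all $\boldsymbol k$), they are projection operators on their respective Fourier spaces $V^\ell_K$, $\ell=0,1,2,3$.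
   Context: Let $L>0$ and let $K\ge0$, $M\ge2K+1$ be integers; set $h=L/M$, $\mathcal K=\{-K,\dots,K\}^3$, $\Lambda_{\boldsymbol k}(\boldsymbol x)=e^{2i\pi\boldsymbol k\cdot\boldsymbol x/L}$, and let $\boldsymbol e_\alpha$ be the unit basis vectors of $\mathbb R^3$. Dimension indices are circular: $\alpha\equiv\alpha+3$. The truncated Fourier spaces are $$V^0_K=V^3_K=\mathrm{Span}\{\Lambda_{\boldsymbol k}:\boldsymbol k\in\mathcal K\},\qquad V^1_K=V^2_K=\mathrm{Span}\{\Lambda_{\boldsymbol k}\boldsymbol e_\alpha:\boldsymbol k\in\mathcal K,\ \alpha=1,2,3\}.$$ Let $\gamma_{\boldsymbol k}=\overline{\gamma_{-\boldsymbol k}}\in\mathbb C$ be arbitrary Hermitian filter coefficients. Function spaces. $\mathcal C^0_{\mathrm{per}}$ is the space of continuous functions that are $L$-periodic in each of the three variables, and $$\mathcal C^1_{\mathrm{per},\alpha}=\{G\in\mathcal C^0_{\mathrm{per}}:\partial_\alpha G\in\mathcal C^0_{\mathrm{per}}\},\qquad \mathcal C^1_{\mathrm{per},\alpha,\beta}=\{G\in\mathcal C^0_{\mathrm{per}}:\partial_\alpha\partial_\beta G\in\mathcal C^0_{\mathrm{per}}\},$$ $$\mathcal C^1_{\mathrm{per},1,2,3}=\{G\in\mathcal C^0_{\mathrm{per}}:\partial_1\partial_2\partial_3 G\in\mathcal C^0_{\mathrm{per}}\}.$$ Conservative DFT. For $\boldsymbol k\in\mathbb Z^3$, $\tilde{\mathcal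 F}_{M,\boldsymbol k}=\tilde{\mathcal F}_{M,k_1}\otimes\tilde{\mathcal F}_{M,k_2}\otimes\tilde{\mathcal F}_{M,k_3}$ is the functional on $\mathcal C^0_{\mathrm{per}}$ obtained by applying in each variable $x_\alpha$ the univariate functional $$\tilde{\mathcal F}_{M,k_\alpha}(g)=\begin{cases}\frac1L\int_0^Lg(x_\alpha)\,dx_\alpha&\text{if }k_\alpha=0,\\ \frac1M\sum_{m=1}^Mg(mh)\,e^{-2i\pi k_\alpha m/M}&\text{if }k_\alpha\ne0.\end{cases}$$ Pseudo-differential operators. For $c\in\mathbb C$ and a function $G$: $\hat D_{\boldsymbol k,\alpha}c=c$ and $\tilde D_{\boldsymbol k,\alpha}G=G$ if $k_\alpha=0$; $\hat D_{\boldsymbol k,\alpha}c=\frac{2i\pi k_\alpha}Lc$ and $\tilde D_{\boldsymbol k,\alpha}G=\partial_\alpha G$ if $k_\alpha\neq0$. Operators $\Pi^\ell$. Each is defined on $V^\ell$ by its Fourier coefficients for $\boldsymbol k\in\mathcal K$: $\Pi^\ell G=\sum_{\boldsymbol k\in\mathcal K}(\Pi^\ell G)_{\boldsymbol k}\Lambda_{\boldsymbol k}$ for $\ell=0,3$, and $\Pi^\ell\boldsymbol G=\sum_{\alpha=1}^3\sum_{\boldsymbol k\in\mathcal K}(\Pi^\ell_\alpha G_\alpha)_{\boldsymbol k}\Lambda_{\boldsymbol k}\boldsymbol e_\alpha$ for $\ell=1,2$, with $$(\Pi^3G)_{\boldsymbol k}=\gamma_{\boldsymbol k}\tilde{\mathcal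 F}_{M,\boldsymbol k}(G),\qquad (\Pi^2_\alpha G_\alpha)_{\boldsymbol k}=\gamma_{\boldsymbol k}(\hat D_{\boldsymbol k,\alpha})^{-1}\tilde{\mathcal F}_{M,\boldsymbol k}(\tilde D_{\boldsymbol k,\alpha}G_\alpha),$$ $$(\Pi^1_\alpha G_\alpha)_{\boldsymbol k}=\gamma_{\boldsymbol k}(\hat D_{\boldsymbol k,\alpha+1}\hat D_{\boldsymbol k,\alpha+2})^{-1}\tilde{\mathcal F}_{M,\boldsymbol k}(\tilde D_{\boldsymbol k,\alpha+1}\tilde D_{\boldsymbol k,\alpha+2}G_\alpha),$$ $$(\Pi^0G)_{\boldsymbol k}=\gamma_{\boldsymbol k}(\hat D_{\boldsymbol k,1}\hat D_{\boldsymbol k,2}\hat D_{\boldsymbol k,3})^{-1}\tilde{\mathcal F}_{M,\boldsymbol k}(\tilde D_{\boldsymbol k,1}\tilde D_{\boldsymbol k,2}\tilde D_{\boldsymbol k,3}G).$$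
   Formalization: In the spaces C^1_{per,α,β} and C^1_{per,1,2,3} the lower-order partial derivatives are also required to exist and be continuous; otherwise, e.g. for G=f(x_1) with f nowhere differentiable, ∇G and Π^0G are undefined. *)

(* Defs.v *)
From HB Require Import structures.
From mathcomp Require Import all_boot all_order all_algebra.
From mathcomp Require Import complex.
From mathcomp Require Import all_classical all_reals all_analysis.
Set Implicit Arguments.
Unset Strict Implicit.
Unset Printing Implicit Defensive.
Import Order.TTheory GRing.Theory Num.Theory numFieldNormedType.Exports.
Local Open Scope classical_set_scope.
Local Open Scope complex_scope.
Local Open Scope ring_scope.

(* Axes are elements of the ring 'I_3 = Z/3Z, so [a + 1] and [a + 2] are the
   circular successors; the axes 1, 2, 3 of R^3 are numbered 0, 1, 2 here. *)
Section PseudoDifferentialDFT.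
Variable R : realType.
Local Notation C := R[i].
Local Notation point := 'rV[R]_3.
Local Notation sfield := (point -> C).
Local Notation vfield := ('I_3 -> sfield).

Definition basis (a : 'I_3) : point := delta_mx 0 a.

Definition mkpoint (t1 t2 t3 : R) : point :=
  \row_(a < 3) tnth [tuple t1; t2; t3] a.

(* exp (i t) *)
Definition expi (t : R) : C := cos t +i* sin t.

Definition partial (a : 'I_3) (G : sfield) : sfield := fun x =>
  'D_(basis a) (fun y => complex.Re (G y)) x +i* 'D_(basis a) (fun y => complex.Im (G y)) x.

Definition has_partial (a : 'I_3) (G : sfield) := forall x : point,
  derivable (fun y => complex.Re (G y)) x (basis a) /\
  derivable (fun y => complex.Im (G y)) x (basis a).

(* partials [:: a; b; c] G = d_a d_b d_c G *)
Definition partials (s : seq 'I_3) (G : sfield) : sfield := foldr partial G s.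

Definition grad (G : sfield) : vfield := fun a => partial a G.
Definition curl (G : vfield) : vfield := fun a =>
  partial (a + 1) (G (a + 2)) - partial (a + 2) (G (a + 1)).
Definition div (G : vfield) : sfield := \sum_(a < 3) partial a (G a).

Variable L : R.

Definition C0per : set sfield := [set G |
  continuous (G : point -> C^o) /\ forall x a, G (x + L *: basis a) = G x].

(* The continuous periodic G whose mixed derivative along s is continuous and
   periodic. The derivatives along the subsequences of s are required to exist
   and to be continuous as well: this does not follow from the existence of the
   top-order one (any G constant in x_3 has d_1 d_2 d_3 G = 0), and
   without it neither the gradient nor the lower-order derivatives in the
   operators below would be defined. *)
Definition C1per (s : seq 'I_3) : set sfield := [set G |
  (forall a t, subseq (a :: t) s -> has_partial a (partials t G)) /\
  (forall t, subseq t s -> C0per (partials t G))].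

Definition V0 : set sfield := C1per [:: 0; 1; 2].
Definition V1 : set vfield := [set G |
  [/\ C1per [:: 1; 2] (G 0), C1per [:: 0; 2] (G 1) & C1per [:: 0; 1] (G 2)]].
Definition V2 : set vfield := [set G |
  [/\ C1per [:: 0] (G 0), C1per [:: 1] (G 1) & C1per [:: 2] (G 2)]].
Definition V3 : set sfield := C0per.

Definition Lambda (k : 'rV[int]_3) : sfield := fun x =>
  expi (2 * pi * (\sum_(a < 3) (k 0 a)%:~R * x 0 a) / L).

Variable K : nat.

(* {-K, ..., K}^3, without repetition *)
Definition modes : seq 'rV[int]_3 :=
  [seq map_mx (fun i : 'I_K.*2.+1 => i%:Z - K%:Z) j | j : 'rV['I_K.*2.+1]_3].

Definition trigpoly (c : 'rV[int]_3 -> C) : sfield := fun x =>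
  \sum_(k <- modes) c k * Lambda k x.

(* V^0_K = V^3_K and V^1_K = V^2_K respectively (complex spans). *)
Definition VKs : set sfield := [set G | exists c, G = trigpoly c].
Definition VKv : set vfield :=
  [set G | exists c : 'I_3 -> 'rV[int]_3 -> C, G = fun a => trigpoly (c a)].

Variable M : nat.

Definition dft1 (n : int) (g : R -> C) : C :=
  if n == 0 then
    (L^-1)%:C * ((\int[lebesgue_measure]_(t in `[0, L]) complex.Re (g t)) +i*
                 (\int[lebesgue_measure]_(t in `[0, L]) complex.Im (g t)))
  else
    M%:R^-1 * \sum_(1 <= m < M.+1)
      g (m%:R * (L / M%:R)) * expi (- (2 * pi * n%:~R * m%:R / M%:R)).

Definition dft (k : 'rV[int]_3) (G : sfield) : C :=
  dft1 (k 0 0) (fun t1 => dft1 (k 0 1) (fun t2 => dft1 (k 0 2) (fun t3 =>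
    G (mkpoint t1 t2 t3)))).

(* Dhat k a is the scalar by which the operator multiplies; its inverse is
   multiplication by (Dhat k a)^-1. *)
Definition Dhat (k : 'rV[int]_3) (a : 'I_3) : C :=
  if k 0 a == 0 then 1 else 'i%C * (2 * pi * (k 0 a)%:~R / L)%:C.
Definition Dtilde (k : 'rV[int]_3) (a : 'I_3) (G : sfield) : sfield :=
  if k 0 a == 0 then G else partial a G.

Variable gamma : 'rV[int]_3 -> C.

Definition Pi3 (G : sfield) : sfield :=
  trigpoly (fun k => gamma k * dft k G).
Definition Pi2 (G : vfield) : vfield := fun a =>
  trigpoly (fun k => gamma k * (Dhat k a)^-1 * dft k (Dtilde k a (G a))).
Definition Pi1 (G : vfield) : vfield := fun a =>
  trigpoly (fun k => gamma k * (Dhat k (a + 1) * Dhat k (a + 2))^-1 *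
    dft k (Dtilde k (a + 1) (Dtilde k (a + 2) (G a)))).
Definition Pi0 (G : sfield) : sfield :=
  trigpoly (fun k => gamma k * (Dhat k 0 * Dhat k 1 * Dhat k 2)^-1 *
    dft k (Dtilde k 0 (Dtilde k 1 (Dtilde k 2 G)))).

(* P restricts to a linear idempotent of the linear space D with range W. *)
Definition projection_onto (E : lmodType C) (D W : set E) (P : E -> E) :=
  [/\ W `<=` D,
      forall (c : C) (u v : E), D u -> D v ->
        D (c *: u + v) /\ P (c *: u + v) = c *: P u + P v,
      forall u, D u -> P (P u) = P u
    & P @` D = W].

End PseudoDifferentialDFT.

(* Main.v *)
(* Along each axis the conservative DFT is a linear functional bounded by the
   sup norm over one period. It therefore preserves continuity and periodicity
   and commutes with the derivatives along the other axes, while for k_a = 0 it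
   kills d_a of a periodic function, by the fundamental theorem of calculus.
   Writing [symbol k a] for 2 i pi k_a / L, this gives, for k_a = 0 and k_a <> 0
   alike,
     dft k (d_a H) = symbol k a * (Dhat k a)^-1 * dft k (Dtilde k a H),
   that is, d_a turns the operator with one pseudo-derivative along a into the
   one without it. Together with Schwarz's theorem, which lets the derivatives
   be reordered, this yields the commuting diagram. Since M >= 2 K + 1 the modes
   are not aliased: dft k Lambda_j = delta_jk for j and k in the modes, whence
   the projection property. *)
Require Import Defs.
From mathcomp Require Import all_boot all_order all_algebra.
From mathcomp Require Import complex ring lra zify.
From mathcomp Require Import all_classical all_reals all_analysis.
Import Order.TTheory GRing.Theory Num.Theory numFieldNormedType.Exports.
Local Open Scope classical_set_scope.
Local Open Scope complex_scope.
Local Open Scope ring_scope.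

(** * Directional derivatives, mean values and Schwarz's theorem *)

Section DirectionalDerivative.
Context {R : realType} {V : normedModType R}.
Implicit Types (f g : V -> R) (u v x : V).

(** The difference quotients of [f] along [v] are literally those of its restriction to a line, so
    one-variable rules apply to directional derivatives. *)
Lemma derive_line f x v d :
  is_derive (0 : R) 1 (fun h : R => f (h *: v + x)) d -> is_derive x v f d.
Proof.
set g := fun h : R => _.
have e : (fun h : R => h^-1 *: ((g \o shift 0) (h *: 1) - g 0)) =
    fun h => h^-1 *: ((f \o shift x) (h *: v) - f x).
  by apply/funext => h; rewrite /g/= [h *: 1]mulr1 addr0 scale0r add0r.
by move=> [+ <-]; rewrite /derivable /derive e; split.
Qed.

Lemma derive_dist f x v (l : R) : (forall e : R, 0 < e -> \forall h \near 0^',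
    `|l - h^-1 * (f (h *: v + x) - f x)| <= e) -> is_derive x v f l.
Proof.
move=> fl; suff H : (fun h : R => h^-1 *: ((f \o shift x) (h *: v) - f x)) @ 0^'
    --> l by split; [apply/cvg_ex; eexists; exact: H | exact/cvg_lim].
exact/cvgrPdist_le.
Qed.

Lemma line_derive f x v (t : R) : derivable f (t *: v + x) v ->
  is_derive t 1 (fun h : R => f (h *: v + x)) ('D_v f (t *: v + x)).
Proof.
move=> df; set y := t *: v + x; set g := fun h : R => _.
have e : (fun h : R => h^-1 *: ((g \o shift t) (h *: 1) - g t)) =
    fun h => h^-1 *: ((f \o shift y) (h *: v) - f y).
  by apply/funext => h; rewrite /g/= [h *: 1]mulr1 scalerDl addrA.
by split; rewrite /derivable /derive e.
Qed.

Lemma derive_translate f a x v d :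
  is_derive (a + x) v f d -> is_derive x v (fun y => f (a + y)) d.
Proof.
set g := fun y : V => _.
have e : (fun h : R => h^-1 *: ((g \o shift x) (h *: v) - g x)) =
    fun h => h^-1 *: ((f \o shift (a + x)) (h *: v) - f (a + x)).
  by apply/funext => h; rewrite /g/= addrCA.
by move=> [+ <-]; rewrite /derivable /derive -e; split.
Qed.

(** This is the one-variable theorem on the line through [x]. Since [h] may be negative, the
    intermediate parameter is located by [|c| <= |h|] instead of an interval. *)
Lemma directional_mvt f x v (h : R) :
  (forall y, derivable f y v) ->
  exists2 c : R, `|c| <= `|h| & f (h *: v + x) - f x = 'D_v f (c *: v + x) * h.
Proof.
move=> df; pose g (t : R) := f (t *: v + x).
have dg (t : R) : is_derive t 1 g ('D_v f (t *: v + x)) by exact: line_derive.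
have cg (A : set R) : {within A, continuous g}.
  apply: continuous_subspaceT => t; apply: differentiable_continuous.
  by apply/derivable1_diffP; apply: ex_derive.
have g0 : f x = g 0 by rewrite /g scale0r add0r.
rewrite g0 -/(g h).
have [h0|h0] := leP 0 h.
  have [c + ->] := MVT_segment h0 (fun t _ => dg t) (cg _).
  by rewrite in_itv/= => /andP[c0 ch]; exists c; rewrite ?subr0 ?ger0_norm.
have [c + e] := MVT_segment (ltW h0) (fun t _ => dg t) (cg _).
rewrite in_itv/= => /andP[ch c0]; exists c.
  by rewrite !ler0_norm ?lerN2// ltW.
by rewrite -opprB e; ring.
Qed.

(* Peano's version: only ['D_u ('D_v f)] is assumed to exist and be continuous;
   the existence of the other mixed derivative is part of the conclusion. *)
Lemma schwarz f u v x :
  (forall y, derivable f y u) -> (forall y, derivable f y v) ->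
  (forall y, derivable ('D_v f) y u) -> continuous ('D_u ('D_v f)) ->
  is_derive x v ('D_u f) ('D_u ('D_v f) x).
Proof.
move=> fu fv fvu cfvu.
apply: derive_dist => e e0.
have /cvgrPdist_le/(_ _ e0)/nbhs_normP[d /= d0 dP] := cfvu x.
(* Coefficients bounded by [m] move [x] by at most [m * (|u| + |v|) < d]; the [+ 1] keeps the
   denominator positive when [u] and [v] vanish. *)
pose m := d / (`|u| + `|v| + 1).
have s0 : 0 < `|u| + `|v| + 1 by rewrite ltr_wpDl// addr_ge0.
have m0 : 0 < m by rewrite divr_gt0.
have small (a b : R) : `|a| <= m -> `|b| <= m ->
    `|'D_u ('D_v f) x - 'D_u ('D_v f) (a *: u + (b *: v + x))| <= e.
  move=> am bm; apply: dP; rewrite /= addrA opprD addrCA subrr addr0 normrN.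
  rewrite (le_lt_trans (ler_normD _ _))// !normrZ.
  rewrite (@le_lt_trans _ _ (m * `|u| + m * `|v|))//.
    by rewrite lerD// ler_wpM2r.
  by rewrite -mulrDr /m mulrAC ltr_pdivrMr// ltr_pM2l// ltrDl.
near=> k => /=.
have k0 : k != 0 by near: k; exact: nbhs_dnbhs_neq.
have km : `|k| <= m.
  by near: k; apply: dnbhs0_le.
have lineu y : (fun h : R => h^-1 *: ((f \o shift y) (h *: u) - f y)) @ 0^'
    --> 'D_u f y by exact: fu.
(* With [k] fixed, letting [h] tend to 0 in the double difference quotient leaves the quotient in
   [k] of ['D_u f]. A non-strict bound valid for all small [h] survives this limit. *)
have q : h^-1 *: (k^-1 *: ((f \o shift (k *: v + x)) (h *: u) - f (k *: v + x))
      - k^-1 *: ((f \o shift x) (h *: u) - f x)) @[h --> 0^'] -->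
    k^-1 *: ('D_u f (k *: v + x) - 'D_u f x).
  rewrite [X in X @ _ --> _](_ : _ = fun h : R => k^-1 *:
    (h^-1 *: ((f \o shift (k *: v + x)) (h *: u) - f (k *: v + x))
      - h^-1 *: ((f \o shift x) (h *: u) - f x))).
    by apply: cvgZl_tmp; apply: cvgB; exact: lineu.
  apply/funext => h; rewrite -!scalerBr !scalerA mulrC.
  by [].
suff : \forall h \near 0^', `|'D_u ('D_v f) x - h^-1 *: (k^-1 *:
   ((f \o shift (k *: v + x)) (h *: u) - f (k *: v + x))
      - k^-1 *: ((f \o shift x) (h *: u) - f x))| <= e.
  exact: (cvgr_to_le (cvg_norm (cvgB (cvg_cst _) q))).
near=> h.
have h0 : h != 0 by near: h; exact: nbhs_dnbhs_neq.
have hm : `|h| <= m by near: h; apply: dnbhs0_le.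
(* Two mean values, of [g] along [v] and then of ['D_v f] along [u], turn the double quotient into
   ['D_u ('D_v f)] at a point close to [x]. *)
pose g y := f (h *: u + y) - f y.
have dg y : is_derive y v g ('D_v f (h *: u + y) - 'D_v f y).
  by apply: is_deriveB; [exact/derive_translate/derivableP | exact/derivableP].
have [c ck ce] := @directional_mvt g x v k
  (fun y => @ex_derive _ _ _ _ _ _ _ (dg y)).
have [b bh be] := @directional_mvt ('D_v f) (c *: v + x) u h fvu.
rewrite -scalerBr [X in k^-1 *: X](_ : _ = g (k *: v + x) - g x); last first.
  by rewrite /g/=; ring.
rewrite ce (@derive_val _ _ _ _ _ _ _ (dg _)) be.
rewrite [_ *: _](_ : _ = 'D_u ('D_v f) (b *: u + (c *: v + x))).
  by apply: small; [exact: le_trans bh hm | exact: le_trans ck km].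
rewrite /GRing.scale/=; field; exact/andP.
Unshelve. all: by end_near. Qed.

End DirectionalDerivative.

(** * Norms, continuity and uniformity for complex-valued functions *)

Section ComplexValued.
Context {R : realType}.
Local Notation C := R[i].
Implicit Types z w : C.

Lemma complexReM z w :
  complex.Re (z * w) =
    complex.Re z * complex.Re w - complex.Im z * complex.Im w.
Proof. by case: z w => [a b] [c d]. Qed.

Lemma complexImM z w :
  complex.Im (z * w) =
    complex.Re z * complex.Im w + complex.Im z * complex.Re w.
Proof. by case: z w => [a b] [c d]. Qed.

Lemma normc_i : `|'i%C : C| = 1.
Proof. by rewrite normc_def/= expr0n expr1n add0r sqrtr1. Qed.

Lemma normc_real (r : R) : `|r%:C| = `|r|%:C.
Proof. by rewrite normc_def/= expr0n addr0 sqrtr_sqr. Qed.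

Lemma norm_expi (r : R) : `|expi r| = 1.
Proof. by rewrite normc_def/= cos2Dsin2 sqrtr1. Qed.

Lemma normc_ge_Im z : `|complex.Im z|%:C <= `|z|.
Proof.
by have := normc_ge_Re (z * 'i%C); rewrite ReiNIm normrN normrM normc_i mulr1.
Qed.

Lemma normc_le_ReIm z (e : R) :
  `|complex.Re z| <= e -> `|complex.Im z| <= e -> `|z| <= (2 * e)%:C.
Proof.
move=> re im; rewrite {1}[z]complexE (le_trans (ler_normD _ _))//.
rewrite normrM normc_i mul1r !normc_real -rmorphD/= lecR; lra.
Qed.

(** In the order of [C] a positive [e] is real, so real radii are enough; the factor 2 absorbs the
    one of [normc_le_ReIm]. *)
Lemma continuousC_dist {T : topologicalType} (G : T -> C) :
  (forall x (r : R), 0 < r -> \forall y \near x, `|G x - G y| <= (2 * r)%:C) ->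
  continuous (G : T -> C^o).
Proof.
move=> cG x; apply/cvgrPdist_le => e; rewrite ltcE/= => /andP[/eqP ime e0].
have -> : e = (2 * (complex.Re e / 2))%:C.
  by rewrite mulrC divfK//; case: e ime {e0} => a b /= ->.
by apply: cG; rewrite divr_gt0.
Qed.

Lemma continuous_ReIm {T : topologicalType} (G : T -> C) :
  continuous (G : T -> C^o) <->
  continuous (fun x => complex.Re (G x)) /\
  continuous (fun x => complex.Im (G x)).
Proof.
split=> [cG|[cre cim]].
  split=> x; apply/cvgrPdist_lt => e e0.
    have /cvgrPdist_lt/(_ e%:C) := cG x; rewrite ltcR => /(_ e0).
    apply: filterS => y; rewrite -ltcR -raddfB; apply: le_lt_trans.
    exact: normc_ge_Re.
  have /cvgrPdist_lt/(_ e%:C) := cG x; rewrite ltcR => /(_ e0).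
  apply: filterS => y; rewrite -ltcR -raddfB; apply: le_lt_trans.
  exact: normc_ge_Im.
apply: continuousC_dist => x r r0.
have /cvgrPdist_le/(_ _ r0) re := cre x.
have /cvgrPdist_le/(_ _ r0) im := cim x.
by near=> y; apply: normc_le_ReIm; rewrite raddfB; near: y.
Unshelve. all: by end_near. Qed.

(** Joint continuity and a finite covering of [A] make the estimate uniform in [t]. Such uniformity
    is what a functional bounded by the sup norm needs to pass to the limit. *)
Lemma compact_uniform {T : topologicalType} (G : T -> R -> C) (A : set R) x :
  compact A -> continuous ((fun p => G p.1 p.2) : T * R -> C^o) ->
  forall e : R, 0 < e -> \forall y \near x, forall t, A t ->
    `|G y t - G x t| <= e%:C.
Proof.
move=> /compact_near_coveringP cA cG e e0.
have e20 : 0 < (e / 2)%:C by rewrite ltcR divr_gt0.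
apply: (cA _ (nbhs x) (fun y t => `|G y t - G x t| <= e%:C)) => t At.
have /cvgrPdist_le/(_ _ e20) [[U1 U2] /= [xU1 tU2] U12] := cG (x, t).
exists (U2, U1) => // -[s y] [/= U2s U1y].
have /= H1 := U12 (y, s) (conj U1y U2s).
have /= H2 := U12 (x, s) (conj (nbhs_singleton xU1) U2s).
rewrite (_ : _ - _ = (G x t - G x s) - (G x t - G y s)); last by ring.
rewrite (le_trans (ler_normB _ _))// (le_trans (lerD H2 H1))//.
by rewrite -rmorphD/= lecR -splitr.
Qed.

End ComplexValued.

(** * Linearity and boundedness of the univariate conservative DFT *)

Section DFT1.
Context {R : realType} (L : R) (M : nat).
Hypotheses (L_gt0 : 0 < L) (M_gt0 : (0 < M)%N).
Local Notation C := R[i].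
Implicit Types f g : R -> C.

Let Iseg (f : R -> R) := \int[lebesgue_measure]_(t in `[0, L]) f t.

Let segment_integrable (f : R -> R) : continuous f ->
  lebesgue_measure.-integrable `[0, L] (EFin \o f).
Proof.
move=> cf; apply: continuous_compact_integrable; first exact: segment_compact.
exact: continuous_subspaceT.
Qed.

Let Iseg_linear a (f g : R -> R) : continuous f -> continuous g ->
  Iseg (fun t => a * f t + g t) = a * Iseg f + Iseg g.
Proof.
move=> cf cg; rewrite /Iseg RintegralD//; last 2 first.
- by apply: segment_integrable => t; apply: cvgMl_tmp; exact: cf.
- exact: segment_integrable.
by rewrite RintegralZl//; exact: segment_integrable.
Qed.

Lemma Rintegral_period_cst (c : R) :
  \int[lebesgue_measure]_(t in `[0, L]) c = c * L.
Proof.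
rewrite Rintegral_cst//; congr (_ * _).
have := lebesgue_measure_itv `[0, L]; rewrite /= lte_fin L_gt0 => ->.
by rewrite /= subr0.
Qed.

Let Iseg_bound (f : R -> R) e : continuous f ->
  (forall t, t \in `[0, L] -> `|f t| <= e) -> `|Iseg f| <= L * e.
Proof.
move=> cf fe; rewrite (le_trans (le_normr_Rintegral _ _))//.
  exact: segment_integrable.
have -> : L * e = \int[lebesgue_measure]_(t in `[0, L]) e.
  by rewrite Rintegral_period_cst mulrC.
have intf : lebesgue_measure.-integrable `[0, L] (EFin \o (fun t => `|f t|)).
  by apply: segment_integrable => t; apply: cvg_norm; exact: cf.
have inte : lebesgue_measure.-integrable `[0, L] (EFin \o (fun=> e)).
  by apply: segment_integrable => t; exact: cvg_cst.
by apply: (le_Rintegral _ intf inte) => // t; exact: fe.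
Qed.

Lemma dft1_linear n (c : C) f g :
  continuous (f : R -> C^o) -> continuous (g : R -> C^o) ->
  dft1 L M n (fun t => c * f t + g t) = c * dft1 L M n f + dft1 L M n g.
Proof.
move=> /continuous_ReIm[cf1 cf2] /continuous_ReIm[cg1 cg2].
rewrite /dft1; case: ifP => _; last first.
  rewrite mulrCA -mulrDr; congr (_ * _); rewrite mulr_sumr -big_split/=.
  by apply: eq_bigr => m _; rewrite mulrDl -[c * _ * _]mulrA.
rewrite mulrCA -mulrDr; congr (_ * _); rewrite -!/(Iseg _).
have cts (a : R) (p q : R -> R) : continuous p -> continuous q ->
    continuous (fun t => a * p t + q t).
  by move=> cp cq t; apply: cvgD; [apply: cvgMl_tmp; exact: cp | exact: cq].
(* A complex scalar mixes real and imaginary parts; each part is nested as [a * p + q] so that real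
   linearity of the integral applies twice. *)
rewrite (_ : (fun t => complex.Re (c * f t + g t)) =
  fun t => complex.Re c * complex.Re (f t)
  + (- complex.Im c * complex.Im (f t) + complex.Re (g t))); last first.
  by apply/funext => t; rewrite raddfD/= complexReM; ring.
rewrite (_ : (fun t => complex.Im (c * f t + g t)) =
  fun t => complex.Re c * complex.Im (f t)
  + (complex.Im c * complex.Re (f t) + complex.Im (g t))); last first.
  by apply/funext => t; rewrite raddfD/= complexImM; ring.
rewrite !Iseg_linear//; try exact: cts.
by case: c => a b /=; simpc; rewrite !addrA.
Qed.

(** Both branches average values of [f] on [[0, L]]: the nodes [m h], [1 <= m <= M], lie there and
    the exponentials have modulus 1. The factor 2 is the price of bounding the two parts of the
    integral separately. *)
Lemma dft1_bound n f (e : R) : continuous (f : R -> C^o) ->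
  (forall t, t \in `[0, L] -> `|f t| <= e%:C) -> `|dft1 L M n f| <= (2 * e)%:C.
Proof.
move=> /continuous_ReIm[cf1 cf2] fe.
have e0 : 0 <= e.
  rewrite -lecR; apply: le_trans (fe 0 _); first exact: normr_ge0.
  by rewrite in_itv/= lexx ltW.
rewrite /dft1; case: ifP => _.
  have h : L^-1 * (L * e) = e by rewrite mulKf// gt_eqF.
  have L0 : 0 <= L^-1 by rewrite invr_ge0 ltW.
  rewrite -h normrM normc_real (ger0_norm L0) mulrCA rmorphM/=.
  apply: ler_wpM2l; first by rewrite lecR.
  apply: normc_le_ReIm; apply: Iseg_bound => //= t /fe fte; rewrite -lecR.
    exact: le_trans (normc_ge_Re _) fte.
  exact: le_trans (normc_ge_Im _) fte.
have M0 : 0 < M%:R :> C by rewrite ltr0n.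
rewrite normrM normfV (gtr0_norm M0) ler_pdivrMl//.
rewrite (le_trans (ler_norm_sum _ _ _))//.
rewrite (@le_trans _ _ (\sum_(1 <= m < M.+1) e%:C))//.
  rewrite big_nat [leRHS]big_nat ler_sum// => m /andP[m1 mM].
  rewrite normrM norm_expi mulr1; apply: fe; rewrite in_itv/=.
  rewrite mulr_ge0 ?divr_ge0 ?ler0n ?(ltW L_gt0)//=.
  rewrite mulrCA ler_piMr ?(ltW L_gt0)//.
  by rewrite ler_pdivrMr ?ltr0n// mul1r ler_nat.
rewrite sumr_const_nat subn1/= -[leLHS]mulr_natl ler_pM2l// lecR; lra.
Qed.

End DFT1.

(** * The DFT along one axis and its interaction with derivatives *)

Section AxisDFT.
Context {R : realType} (L : R) (M : nat).
Hypotheses (L_gt0 : 0 < L) (M_gt0 : (0 < M)%N).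
Local Notation C := R[i].
Local Notation point := 'rV[R]_3.
Local Notation sfield := (point -> C).
Local Notation e_ := (@Defs.basis R).
Implicit Types (x : point) (a b : 'I_3) (G H : sfield).

(** Written as a displacement along [e_ a], the replacement commutes with displacements along other
    axes and runs through the lines on which derivatives are taken. *)
Definition set_coord x a (t : R) : point := x + (t - x 0 a) *: e_ a.

Lemma set_coordE x a t b : set_coord x a t 0 b = if b == a then t else x 0 b.
Proof.
rewrite !mxE eqxx /=; case: eqP => [->|_]; first by rewrite mulr1 subrKC.
by rewrite mulr0 addr0.
Qed.

Lemma set_coord_basis x a b h t : b != a ->
  set_coord (h *: e_ b + x) a t = h *: e_ b + set_coord x a t.
Proof.
move=> ba; rewrite /set_coord !mxE eqxx/= eq_sym (negPf ba) mulr0 add0r.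
by rewrite addrA.
Qed.

Lemma set_coord_basis_same x a h t :
  set_coord (h *: e_ a + x) a t = set_coord x a t.
Proof.
apply/rowP => b; rewrite !set_coordE !mxE eqxx/=.
by case: eqP => // _; rewrite mulr0 add0r.
Qed.

Lemma set_coord_line x a t : set_coord x a t = t *: e_ a + set_coord x a 0.
Proof. by rewrite /set_coord sub0r scaleNr scalerBl addrCA. Qed.

Lemma continuous_set_coord a :
  continuous (fun p : point * R => set_coord p.1 a p.2).
Proof.
move=> [x t]; apply: cvgD; first exact: cvg_fst.
apply: cvgZ; last exact: cvg_cst.
apply: cvgB; first exact: cvg_snd.
apply: (cvg_comp _ (fun y : point => y 0 a)); first exact: cvg_fst.
exact: coord_continuous.
Qed.

Lemma continuous_along (G : sfield) x a : continuous (G : point -> C^o) ->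
  continuous ((fun t => G (set_coord x a t)) : R -> C^o).
Proof.
move=> cG t; apply: (cvg_comp _ G); last exact: cG.
apply: cvgD; first exact: cvg_cst.
apply: cvgZ; last exact: cvg_cst.
by apply: cvgB; [exact: cvg_id | exact: cvg_cst].
Qed.

(** The result remains a function of all three variables, constant in the variable [a], so that the
    transforms of the three axes compose as operators on one space. *)
Definition axis_dft n a G : sfield :=
  fun x => dft1 L M n (fun t => G (set_coord x a t)).

Lemma axis_dft_linear n a (c : C) G H :
  continuous (G : point -> C^o) -> continuous (H : point -> C^o) ->
  axis_dft n a (c *: G + H) = c *: axis_dft n a G + axis_dft n a H.
Proof.
move=> cG cH; apply/funext => x; rewrite /axis_dft.
by apply: dft1_linear; exact: continuous_along.
Qed.

(** By linearity the variation of the transform is the transform of the variation of [G], which is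
    uniformly small on the compact period. *)
Lemma continuous_axis_dft n a G : continuous (G : point -> C^o) ->
  continuous (axis_dft n a G : point -> C^o).
Proof.
move=> cG; apply: continuousC_dist => x r r0.
have cG2 : continuous ((fun p => G (set_coord p.1 a p.2)) : point * R -> C^o).
  move=> p; apply: (cvg_comp _ G); last exact: cG.
  exact: continuous_set_coord.
have := compact_uniform (fun y t => G (set_coord y a t)) _ x
  (@segment_compact _ 0 L) cG2 _ r0.
apply: filterS => y yr.
rewrite distrC /axis_dft.
have -> : dft1 L M n (fun t => G (set_coord y a t))
    - dft1 L M n (fun t => G (set_coord x a t)) =
  dft1 L M n (fun t => -1 * G (set_coord x a t) + G (set_coord y a t)).
  by rewrite dft1_linear ?mulN1r 1?addrC//; exact: continuous_along.
apply: dft1_bound => // [t|t tL]; last by rewrite mulN1r addrC; exact: yr.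
by apply: cvgD; [apply: cvgMl_tmp|]; exact: continuous_along.
Qed.

Lemma C0per_axis_dft n a G : C0per L G -> C0per L (axis_dft n a G).
Proof.
move=> [cG pG]; split; first exact: continuous_axis_dft.
move=> x b; rewrite addrC /axis_dft; congr (dft1 L M n _); apply/funext => t.
have [->|ba] := eqVneq b a; first by rewrite set_coord_basis_same.
by rewrite set_coord_basis// addrC pG.
Qed.

(** The left-hand side is the derivative minus its difference quotient, arranged in the shape
    [c * f + g] of [dft1_linear]. Real and imaginary parts need separate intermediate points, hence
    the factor 2. *)
Lemma partial_quotient H b y (h e : R) : h != 0 -> has_partial b H ->
  (forall c : R, `|c| <= `|h| ->
     `|partial b H (c *: e_ b + y) - partial b H y| <= e%:C) ->
  `|- (h^-1)%:C * H (h *: e_ b + y) + ((h^-1)%:C * H y + partial b H y)|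
    <= (2 * e)%:C.
Proof.
move=> h0 dH close.
have [c ch ce] := @directional_mvt _ _ _ y (e_ b) h (fun y => (dH y).1).
have [d dh de] := @directional_mvt _ _ _ y (e_ b) h (fun y => (dH y).2).
apply: normc_le_ReIm.
  have := le_trans (normc_ge_Re _) (close c ch); rewrite lecR; apply: le_trans.
  rewrite raddfB/= distrC !raddfD/= !complexReM/= oppr0 !mul0r !subr0.
  rewrite (_ : _ + _ = 'D_(e_ b) (fun z => complex.Re (H z)) y - h^-1 *
    (complex.Re (H (h *: e_ b + y)) - complex.Re (H y))); last by ring.
  by rewrite ce mulrCA mulVf ?mulr1.
have := le_trans (normc_ge_Im _) (close d dh); rewrite lecR; apply: le_trans.
rewrite raddfB/= distrC !raddfD/= !complexImM/= oppr0 !mul0r !addr0.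
rewrite (_ : _ + _ = 'D_(e_ b) (fun z => complex.Im (H z)) y - h^-1 *
  (complex.Im (H (h *: e_ b + y)) - complex.Im (H y))); last by ring.
by rewrite de mulrCA mulVf ?mulr1.
Qed.

(** Difference quotients of [H] along [b] converge to [partial b H] uniformly on the segment in
    direction [a], and [dft1] is bounded by the sup norm, so the limit passes through it. *)
Lemma axis_dft_partial n a b H : b != a ->
  continuous (H : point -> C^o) -> has_partial b H ->
  continuous (partial b H : point -> C^o) ->
  has_partial b (axis_dft n a H) /\
  partial b (axis_dft n a H) = axis_dft n a (partial b H).
Proof.
move=> ba cH dH cdH.
pose A x := axis_dft n a H x; pose B x := axis_dft n a (partial b H) x.
have quotient x (e : R) : 0 < e -> \forall h \near 0^',
    `|B x - (h^-1)%:C * (A (h *: e_ b + x) - A x)| <= e%:C.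
  (* The divisor 4 collects one factor 2 from [partial_quotient] and one from [dft1_bound]. *)
  move=> e0; have e40 : 0 < e / 4 by rewrite divr_gt0.
  have cG2 : continuous
      ((fun p => partial b H (set_coord p.1 a p.2)) : point * R -> C^o).
    move=> p; apply: (cvg_comp _ (partial b H)); last exact: cdH.
    exact: continuous_set_coord.
  have /nbhs_normP[d /= d0 dP] := compact_uniform
    (fun y t => partial b H (set_coord y a t)) _ x
    (@segment_compact _ 0 L) cG2 _ e40.
  have m0 : 0 < d / (`|e_ b| + 1) by rewrite divr_gt0// ltr_wpDl.
  near=> h.
  have h0 : h != 0 by near: h; exact: nbhs_dnbhs_neq.
  have hm : `|h| < d / (`|e_ b| + 1) by near: h; exact: dnbhs0_lt.
  have close c t : `|c| <= `|h| -> t \in `[0, L] ->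
      `|partial b H (c *: e_ b + set_coord x a t)
        - partial b H (set_coord x a t)| <= (e / 4)%:C.
    move=> ch tL; rewrite -set_coord_basis//; apply: dP => //=.
    rewrite opprD addrCA subrr addr0 normrN normrZ.
    rewrite (@le_lt_trans _ _ (`|h| * (`|e_ b| + 1)))//.
      by rewrite ler_pM// lerDl.
    by rewrite -ltr_pdivlMr// ltr_wpDl.
  set c := (h^-1)%:C.
  have -> : B x - c * (A (h *: e_ b + x) - A x) =
      dft1 L M n (fun t => - c * H (set_coord (h *: e_ b + x) a t)
        + (c * H (set_coord x a t) + partial b H (set_coord x a t))).
    rewrite !dft1_linear /A /B /axis_dft; first ring;
      try exact: continuous_along.
    by move=> t; apply: cvgD; [apply: cvgMl_tmp|]; exact: continuous_along.
  rewrite (_ : e = 2 * (2 * (e / 4))); last by field.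
  apply: dft1_bound => // [t|t tL].
    apply: cvgD; [apply: cvgMl_tmp | apply: cvgD; first apply: cvgMl_tmp];
      exact: continuous_along.
  by rewrite set_coord_basis//; apply: partial_quotient => // u /close; exact.
have dre x : is_derive x (e_ b) (fun y => complex.Re (A y)) (complex.Re (B x)).
  apply: derive_dist => e /(quotient x); apply: filterS => h; rewrite -lecR.
  apply: le_trans; rewrite (le_trans _ (normc_ge_Re _))// raddfB/= complexReM/=.
  by rewrite mul0r subr0 raddfB.
have dim x : is_derive x (e_ b) (fun y => complex.Im (A y)) (complex.Im (B x)).
  apply: derive_dist => e /(quotient x); apply: filterS => h; rewrite -lecR.
  apply: le_trans; rewrite (le_trans _ (normc_ge_Im _))// raddfB/= complexImM/=.
  by rewrite mul0r addr0 raddfB.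
split=> [x|].
  by split; [exact: (@ex_derive _ _ _ _ _ _ _ (dre x))
            | exact: (@ex_derive _ _ _ _ _ _ _ (dim x))].
apply/funext => x.
rewrite /partial (@derive_val _ _ _ _ _ _ _ (dre x)).
by rewrite (@derive_val _ _ _ _ _ _ _ (dim x)) -/(B x); case: (B x).
Unshelve. all: by end_near. Qed.

Lemma integral_derivative_periodic (f : point -> R) x a :
  (forall y, derivable f y (e_ a)) -> continuous ('D_(e_ a) f) ->
  (forall y, f (y + L *: e_ a) = f y) ->
  \int[lebesgue_measure]_(t in `[0, L]) 'D_(e_ a) f (set_coord x a t) = 0.
Proof.
move=> df cdf pf.
pose F t := f (t *: e_ a + set_coord x a 0).
have dF (t : R) : is_derive t 1 F ('D_(e_ a) f (set_coord x a t)).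
  by rewrite set_coord_line; exact: line_derive.
have cF : continuous F.
  move=> t; apply: differentiable_continuous; apply/derivable1_diffP.
  exact: (@ex_derive _ _ _ _ _ _ _ (dF t)).
have cD : continuous (fun t : R => 'D_(e_ a) f (set_coord x a t)).
  move=> t; apply: (cvg_comp _ ('D_(e_ a) f)); last exact: cdf.
  apply: cvgD; first exact: cvg_cst.
  apply: cvgZ; last exact: cvg_cst.
  by apply: cvgB; [exact: cvg_id | exact: cvg_cst].
rewrite /Rintegral (continuous_FTC2 (F := F) L_gt0).
- by rewrite /F scale0r add0r [_ *: _ + _]addrC pf subee.
- exact: continuous_subspaceT.
- split=> [t _||]; first exact: (@ex_derive _ _ _ _ _ _ _ (dF t)).
    by apply: cvg_at_right_filter; exact: cF.
  by apply: cvg_at_left_filter; exact: cF.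
- by move=> t _; rewrite derive1E (@derive_val _ _ _ _ _ _ _ (dF t)).
Qed.

(** It is here that frequency 0 has to use the exact integral: a mean of finitely many samples of a
    derivative need not vanish. *)
Lemma axis_dft0_partial a H :
  C0per L H -> has_partial a H -> continuous (partial a H : point -> C^o) ->
  axis_dft 0 a (partial a H) = 0.
Proof.
move=> [cH pH] dH /continuous_ReIm[cre cim]; apply/funext => x.
rewrite /axis_dft /dft1 eqxx /partial /=.
have re0 : \int[lebesgue_measure]_(t in `[0, L])
    'D_(e_ a) (fun y => complex.Re (H y)) (set_coord x a t) = 0.
  apply: integral_derivative_periodic cre _ => y; first exact: (dH y).1.
  by rewrite pH.
have im0 : \int[lebesgue_measure]_(t in `[0, L])
    'D_(e_ a) (fun y => complex.Im (H y)) (set_coord x a t) = 0.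
  apply: integral_derivative_periodic cim _ => y; first exact: (dH y).2.
  by rewrite pH.
rewrite re0 im0.
exact: mulr0.
Qed.

End AxisDFT.

(** * Mixed partial derivatives and the spaces [C1per] *)

Section MixedPartials.
Context {R : realType} (L : R).
Local Notation C := R[i].
Local Notation point := 'rV[R]_3.
Local Notation sfield := (point -> C).
Local Notation e_ := (@Defs.basis R).
Implicit Types (x : point) (a b : 'I_3) (s t : seq 'I_3) (G H u v : sfield).

Lemma has_partial_linear a (c : C) u v : has_partial a u -> has_partial a v ->
  has_partial a (c *: u + v) /\
  partial a (c *: u + v) = c *: partial a u + partial a v.
Proof.
move=> du dv.
pose re (w : sfield) x := complex.Re (w x).
pose im (w : sfield) x := complex.Im (w x).
have part_derive (p : C -> R) (w : sfield) x :
    derivable (fun y => p (w y)) x (e_ a) ->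
    is_derive x (e_ a) (fun y => p (w y)) ('D_(e_ a) (fun y => p (w y)) x).
  exact: derivableP.
have dre x : is_derive x (e_ a) (re (c *: u + v))
    (complex.Re c *: 'D_(e_ a) (re u) x - complex.Im c *: 'D_(e_ a) (im u) x
     + 'D_(e_ a) (re v) x).
  rewrite (_ : re _ = complex.Re c *: re u - complex.Im c *: im u + re v).
    have r := part_derive (@complex.Re R) u x (du x).1.
    have i := part_derive (@complex.Im R) u x (du x).2.
    have r' := part_derive (@complex.Re R) v x (dv x).1.
    exact: (is_deriveD (is_deriveB (is_deriveZ _ r) (is_deriveZ _ i)) r').
  by apply/funext => y; rewrite /re /= raddfD/= complexReM.
have dim x : is_derive x (e_ a) (im (c *: u + v))
    (complex.Re c *: 'D_(e_ a) (im u) x + complex.Im c *: 'D_(e_ a) (re u) x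
     + 'D_(e_ a) (im v) x).
  rewrite (_ : im _ = complex.Re c *: im u + complex.Im c *: re u + im v).
    have r := part_derive (@complex.Re R) u x (du x).1.
    have i := part_derive (@complex.Im R) u x (du x).2.
    have i' := part_derive (@complex.Im R) v x (dv x).2.
    exact: (is_deriveD (is_deriveD (is_deriveZ _ i) (is_deriveZ _ r)) i').
  by apply/funext => y; rewrite /im /= raddfD/= complexImM.
split=> [x|].
  by split; [exact: (@ex_derive _ _ _ _ _ _ _ (dre x))
            | exact: (@ex_derive _ _ _ _ _ _ _ (dim x))].
apply/funext => x.
rewrite {1}/partial (@derive_val _ _ _ _ _ _ _ (dre x)).
rewrite (@derive_val _ _ _ _ _ _ _ (dim x)).
by apply/eqP; rewrite eq_complex !raddfD/= complexReM complexImM !eqxx.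
Qed.

(** Peano's form of Schwarz's theorem is applied to both parts. That the exchanged derivative exists
    must be a conclusion, because [C1per s] only speaks of derivatives taken in the order of [s]. *)
Lemma partial_comm a b G : has_partial a G -> has_partial b G ->
  has_partial b (partial a G) ->
  continuous (partial b (partial a G) : point -> C^o) ->
  has_partial a (partial b G) /\
  partial a (partial b G) = partial b (partial a G).
Proof.
move=> da db dba /continuous_ReIm[cre cim].
have dre x := @schwarz _ _ (fun y => complex.Re (G y)) (e_ b) (e_ a) x
  (fun y => (db y).1) (fun y => (da y).1) (fun y => (dba y).1) cre.
have dim x := @schwarz _ _ (fun y => complex.Im (G y)) (e_ b) (e_ a) x
  (fun y => (db y).2) (fun y => (da y).2) (fun y => (dba y).2) cim.
split=> [x|].
  by split; [exact: (@ex_derive _ _ _ _ _ _ _ (dre x))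
            | exact: (@ex_derive _ _ _ _ _ _ _ (dim x))].
apply/funext => x; rewrite {1}/partial.
rewrite (@derive_val _ _ _ _ _ _ _ (dre x)).
by rewrite (@derive_val _ _ _ _ _ _ _ (dim x)).
Qed.

Lemma C0per_linear (c : C) u v : C0per L u -> C0per L v -> C0per L (c *: u + v).
Proof.
move=> [cu pu] [cv pv]; split=> [|x a].
  suff : continuous ((fun y => c * u y + v y) : point -> C^o) by [].
  move=> x.
  exact: (cvgD (cvgMl_tmp (cu x)) (cv x)).
by rewrite -[LHS]/(c * u _ + v _) pu pv.
Qed.

Lemma partials_linear s (c : C) u v t : C1per L s u -> C1per L s v ->
  subseq t s -> partials t (c *: u + v) = c *: partials t u + partials t v.
Proof.
move=> [du _] [dv _]; elim: t => //= a t IH ts.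
rewrite IH; last exact: subseq_trans (subseq_cons _ _) ts.
by have [_ ->] := has_partial_linear a c _ _ (du _ _ ts) (dv _ _ ts).
Qed.

Lemma C1per_linear s (c : C) u v :
  C1per L s u -> C1per L s v -> C1per L s (c *: u + v).
Proof.
move=> cu cv; split=> [a t ts|t ts]; rewrite (partials_linear s)//.
- by have [] := has_partial_linear a c _ _ (cu.1 _ _ ts) (cv.1 _ _ ts).
- exact: subseq_trans (subseq_cons _ _) ts.
- by apply: C0per_linear; [exact: cu.2 | exact: cv.2].
Qed.

Lemma C1per_nil G : C1per L [::] G <-> C0per L G.
Proof.
split=> [[_ cG]|cG]; first exact: (cG [::]).
by split=> [a t|t]; rewrite subseq0//= => /eqP ->.
Qed.

Let subseq1P a t : subseq t [:: a] -> t = [::] \/ t = [:: a].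
Proof.
case: t => [|b t] st; [by left | right].
have := size_subseq st; have := mem_subseq st (mem_head _ _).
by rewrite inE => /eqP ->; case: t st.
Qed.

Lemma C1per_seq1 a G : C1per L [:: a] G <->
  [/\ C0per L G, has_partial a G & C0per L (partial a G)].
Proof.
split=> [[dG cG]|[cG dG cdG]].
  split; first by apply: (cG [::]); exact: sub0seq.
  - exact: (dG a [::]).
  - exact: (cG [:: a]).
split=> [b t|t] /subseq1P[].
- discriminate.
- by case=> -> ->.
- by move=> ->.
- by move=> ->; exact: cdG.
Qed.

(* Induction on the length of [t]: if the first axis of [t] is not the first one
   in the order of [s], Schwarz's theorem exchanges the two. *)
Lemma partials_reorder s G t : uniq s -> C1per L s G ->
  uniq t -> {subset t <= s} ->
  (forall a t', t = a :: t' -> has_partial a (partials t' G)) /\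
  partials t G = partials [seq b <- s | b \in t] G.
Proof.
move=> us [dG cG]; have [n] := ubnP (size t); elim: n t => // n IH [|a t].
  by move=> _ _ _; split=> //; rewrite (eq_filter (a2 := pred0))// filter_pred0.
rewrite ltnS => tn uat ats.
have sub_eq w (w' : seq 'I_3) : subseq w s -> w =i w' ->
    [seq b <- s | b \in w'] = w.
  move=> /(subseq_uniqP us) {2}-> ww'.
  by apply: eq_filter => c; rewrite /= ww'.
have [t_u at_u] : uniq t /\ a \notin t by case/andP: uat.
have ts : {subset t <= s} by move=> c ct; apply: ats; rewrite inE ct orbT.
set N := [seq b <- s | b \in a :: t].
have Ns : subseq N s by exact: filter_subseq.
have Nat : N =i a :: t.
  by move=> c; rewrite mem_filter; case: (boolP (c \in a :: t)) => // /ats.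
have uN : uniq N by exact: filter_uniq.
have sN : size N = (size t).+1 by exact: perm_size (uniq_perm uN uat Nat).
clearbody N; case: N => // b u in Ns Nat uN sN *.
have [ub bu] : uniq u /\ b \notin u by case/andP: uN.
have us' : subseq u s by exact: subseq_trans (subseq_cons _ _) Ns.
(* Here [b] is the axis of [a :: t] that comes first in [s]; if it is [a], induction on the tail
   suffices. *)
have [ba|ba] := eqVneq b a.
  have ut : u =i t.
    move=> c; have := Nat c; rewrite ba !inE.
    by have [->|] := eqVneq c a; rewrite // (negPf at_u) -ba (negPf bu).
  have [_ e] := IH t tn t_u ts.
  rewrite (sub_eq u t us' ut) in e.
  split; last by rewrite /= e ba.
  by move=> c t' [<- <-]; rewrite e; apply: dG; rewrite -ba.
have au : a \in u by have := Nat a; rewrite !inE eqxx eq_sym (negPf ba).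
(* Otherwise the reordering goes from [a :: t] to [a :: b :: w], then [b :: a :: w], then [b :: u].
   The outer moves are induction on the shorter lists [t], [b :: w] and [a :: w]; the middle one is
   Schwarz's theorem. *)
pose w := rem a u.
have mw c : (c \in w) = (c != a) && (c \in u) by rewrite mem_rem_uniq// inE.
have uw : uniq w by exact: rem_uniq.
have sw : (size w).+1 = size t.
  rewrite size_rem// prednK; first by case: sN.
  by rewrite -has_predT; apply/hasP; exists a.
have mt c : (c \in t) = (c == b) || (c \in w).
  rewrite mw; have := Nat c; rewrite !inE.
  have [->|ca] := eqVneq c a; last by move=> /= <-.
  by rewrite (negPf at_u) eq_sym (negPf ba).
have [_ et] := IH t tn t_u ts.
have ws : {subset w <= s} by move=> c; rewrite mw => /andP[_ /(mem_subseq us')].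
have [bwd bwe] :
    (forall c t', b :: w = c :: t' -> has_partial c (partials t' G)) /\
    partials (b :: w) G = partials t G.
  have [|||? ->] := IH (b :: w).
  - by rewrite /= sw.
  - by rewrite /= uw mw (negPf bu) andbF.
  - move=> c; rewrite inE => /predU1P[->|/ws//].
    by rewrite (mem_subseq Ns)// mem_head.
  - rewrite et; split=> //; congr (partials _ G); apply: eq_filter => c.
    by rewrite /= inE mt.
have [awd awe] :
    (forall c t', a :: w = c :: t' -> has_partial c (partials t' G)) /\
    partials (a :: w) G = partials u G.
  have [|||? ->] := IH (a :: w).
  - by rewrite /= sw.
  - by rewrite /= uw mw eqxx.
  - by move=> c; rewrite inE => /predU1P[->|/ws//]; rewrite (mem_subseq us').
  - split=> //; congr (partials _ G); apply: sub_eq => // c.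
    by rewrite inE mw; have [->|] := eqVneq c a; rewrite ?au.
have [] := @partial_comm a b (partials w G).
- exact: awd.
- exact: bwd.
- by have := dG b u Ns; rewrite -awe.
- by have := cG (b :: u) Ns; rewrite /= -awe => -[].
- move=> /= dab eab; split; first by move=> c t' [<- <-]; rewrite -bwe.
  by rewrite /= -awe -bwe.
Qed.

(** Reordering makes the space depend only on the set of axes, which reconciles the increasing lists
    of the domains with circular indices. *)
Lemma C1per_subset s t G : uniq s -> uniq t -> {subset t <= s} ->
  C1per L s G -> C1per L t G.
Proof.
move=> us ut ts cG; split=> [a w wt|w wt].
  have [H _] := partials_reorder s G (a :: w) us cG (subseq_uniq wt ut)
    (fun c cw => ts c (mem_subseq wt cw)).
  exact: H.
have [_ ->] := partials_reorder s G w us cG (subseq_uniq wt ut)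
    (fun c cw => ts c (mem_subseq wt cw)).
by apply: cG.2; exact: filter_subseq.
Qed.

Lemma partials_perm s t t' G : uniq s -> C1per L s G -> uniq t ->
  {subset t <= s} -> perm_eq t t' -> partials t G = partials t' G.
Proof.
move=> us cG ut ts tt'.
have ts' : {subset t' <= s} by move=> c; rewrite -(perm_mem tt'); exact: ts.
have ut' : uniq t' by rewrite -(perm_uniq tt').
have [_ ->] := partials_reorder s G t us cG ut ts.
have [_ ->] := partials_reorder s G t' us cG ut' ts'.
by congr (partials _ G); apply: eq_filter => c; rewrite (perm_mem tt').
Qed.

(** In [partials t (partial a G)] the axis [a] acts first and so ends the list, whereas it heads
    [a :: s]; [partials_reorder] bridges the two. *)
Lemma C1per_partial a s G : uniq (a :: s) ->
  C1per L (a :: s) G -> C1per L s (partial a G).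
Proof.
move=> uas cG; have [nas us] : a \notin s /\ uniq s by case/andP: uas.
have ras t : partials t (partial a G) = partials (rcons t a) G.
  by rewrite /partials foldr_rcons.
have cs t : subseq t s -> uniq (rcons t a) /\ {subset rcons t a <= a :: s}.
  move=> ts; have nat_ : a \notin t by apply: contra nas => /(mem_subseq ts).
  rewrite rcons_uniq (subseq_uniq ts us) andbT; split=> //.
  move=> c; rewrite mem_rcons !inE => /orP[->//|/(mem_subseq ts) ->].
  by rewrite orbT.
split=> [b t ts|t ts]; have [u1 s1] := cs _ ts; rewrite ras.
  have [H _] := partials_reorder _ _ _ uas cG u1 s1.
  exact: H.
have [_ ->] := partials_reorder _ _ _ uas cG u1 s1.
by apply: cG.2; exact: filter_subseq.
Qed.

End MixedPartials.

(** * The three-dimensional DFT of derivatives and of Fourier modes *)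

Section FourierModes.
Context {R : realType} (L : R) (M : nat).
Hypotheses (L_gt0 : 0 < L) (M_gt0 : (0 < M)%N).
Local Notation C := R[i].
Local Notation point := 'rV[R]_3.
Local Notation sfield := (point -> C).
Local Notation e_ := (@Defs.basis R).
Implicit Types (x : point) (a b : 'I_3) (j k : 'rV[int]_3) (G H u v : sfield).

Lemma ord3_ind (P : 'I_3 -> Prop) : P 0 -> P 1 -> P 2 -> forall a, P a.
Proof.
move=> P0 P1 P2 [[|[|[|//]]] i]; [move: P0 | move: P1 | move: P2];
  by congr P; apply/val_inj.
Qed.

Lemma sum3 (V : nmodType) (F : 'I_3 -> V) : \sum_(a < 3) F a = F 0 + F 1 + F 2.
Proof.
rewrite !big_ord_recr big_ord0 /= add0r.
by congr (F _ + F _ + F _); apply/val_inj.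
Qed.

Lemma mkpointE (t1 t2 t3 : R) : mkpoint t1 t2 t3 =
  set_coord (set_coord (set_coord 0 0 t1) 1 t2) 2 t3.
Proof.
by apply/rowP; apply: ord3_ind; rewrite !set_coordE /= mxE (tnth_nth 0).
Qed.

(** Since all three coordinates of the base point are overwritten, evaluation at [0] is an arbitrary
    choice. *)
Lemma dftE k G : dft L M k G = axis_dft L M (k 0 0) 0
  (axis_dft L M (k 0 1) 1 (axis_dft L M (k 0 2) 2 G)) 0.
Proof.
rewrite /dft /axis_dft; do 3!(congr (dft1 L M _ _); apply/funext => ?).
by rewrite mkpointE.
Qed.

Lemma dft_linear k (c : C) u v : C0per L u -> C0per L v ->
  dft L M k (c *: u + v) = c * dft L M k u + dft L M k v.
Proof.
have cA n a w : C0per L w -> C0per L (axis_dft L M n a w).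
  exact: C0per_axis_dft.
have lA n a w w' : C0per L w -> C0per L w' ->
    axis_dft L M n a (c *: w + w') =
    c *: axis_dft L M n a w + axis_dft L M n a w'.
  by move=> [cw _] [cw' _]; exact: axis_dft_linear.
move=> cu cv; rewrite !dftE (lA _ _ _ _ cu cv).
by rewrite (lA _ _ _ _ (cA _ _ _ cu) (cA _ _ _ cv)) (lA _ _ _ _
  (cA _ _ _ (cA _ _ _ cu)) (cA _ _ _ (cA _ _ _ cv))).
Qed.

Lemma C1per_axis_dft n a b H : b != a -> C1per L [:: b] H ->
  C1per L [:: b] (axis_dft L M n a H) /\
  axis_dft L M n a (partial b H) = partial b (axis_dft L M n a H).
Proof.
move=> ba /C1per_seq1[cH dH cdH].
have [dA eA] := axis_dft_partial L M L_gt0 M_gt0 n a b H ba cH.1 dH cdH.1.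
split; last exact: esym eA.
apply/C1per_seq1; split; [exact: C0per_axis_dft | exact: dA |].
by rewrite eA; exact: C0per_axis_dft.
Qed.

Lemma axis_dft_0 n a : axis_dft L M n a 0 = 0.
Proof.
have c0 : continuous ((0 : sfield) : point -> C^o) by exact: cst_continuous.
have := axis_dft_linear L M n a (-1) 0 0 c0 c0.
by rewrite scaler0 addr0 scaleN1r addNr.
Qed.

(** The derivative is moved outwards through the transforms of the other axes until it meets that of
    its own axis, which kills it; the transforms still outside send 0 to 0. *)
Lemma dft_partial_eq0 k a H : k 0 a = 0 -> C1per L [:: a] H ->
  dft L M k (partial a H) = 0.
Proof.
have A0 b G : C1per L [:: b] G -> axis_dft L M 0 b (partial b G) = 0.
  move=> /C1per_seq1[cG dG cdG].
  by apply: axis_dft0_partial => //; exact: cdG.1.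
rewrite dftE; elim/ord3_ind: a => ka cH; rewrite ?ka.
- have [//|c2 ->] := C1per_axis_dft (k 0 2) 2 _ _ _ cH.
  have [//|c1 ->] := C1per_axis_dft (k 0 1) 1 _ _ _ c2.
  by rewrite A0.
- have [//|c2 ->] := C1per_axis_dft (k 0 2) 2 _ _ _ cH.
  by rewrite A0// axis_dft_0.
- by rewrite A0// !axis_dft_0.
Qed.

(** This is the genuine Fourier multiplier of the derivative: unlike [Dhat], it vanishes at
    frequency 0. *)
Definition symbol k a : C := 'i%C * (2 * pi * (k 0 a)%:~R / L)%:C.

Lemma symbol_neq0 k a : k 0 a != 0 -> symbol k a != 0.
Proof.
move=> ka; rewrite mulf_neq0//.
  by rewrite eq_complex /= eqxx/= oner_eq0.
rewrite eq_complex /= eqxx andbT.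
by rewrite !mulf_neq0 ?invr_neq0 ?intr_eq0 ?ka ?lt0r_neq0 ?pi_gt0.
Qed.

(** At nonzero frequency [symbol] and [Dhat] agree and cancel; at frequency 0 both sides vanish. *)
Lemma dft_partial k a H : C1per L [:: a] H ->
  dft L M k (partial a H) =
    symbol k a * (Dhat L k a)^-1 * dft L M k (Dtilde k a H).
Proof.
move=> cH; rewrite /Dhat /Dtilde; have [ka|ka] := eqVneq (k 0 a) 0.
  by rewrite dft_partial_eq0// /symbol ka mulr0 mul0r rmorph0 mulr0 !mul0r.
by rewrite divff ?mul1r// symbol_neq0.
Qed.

Lemma expiD (s t : R) : expi (s + t) = expi s * expi t.
Proof. by rewrite /expi cosD sinD; simpc; congr (_ +i* _); rewrite addrC. Qed.

Lemma expi0 : expi 0 = 1 :> C.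
Proof. by rewrite /expi cos0 sin0. Qed.

Lemma expiX (t : R) n : expi t ^+ n = expi (n%:R * t).
Proof.
elim: n => [|n IH]; first by rewrite mul0r expi0.
by rewrite exprS IH -expiD -[n.+1]add1n natrD mulrDl mul1r.
Qed.

Lemma expi_2pi (d : int) : expi (2 * pi * d%:~R) = 1 :> C.
Proof.
have expi_nat n : expi (2 * pi * n%:R) = 1 :> C.
  rewrite mulrC -expiX (_ : expi _ = 1) ?expr1n// /expi mulr_natl.
  by rewrite cos2pi sin2pi.
case: d => n; first exact: expi_nat.
rewrite NegzE mulrNz mulrN -[LHS]mulr1 -[X in _ * X](expi_nat n.+1) -expiD.
by rewrite addNr expi0.
Qed.

(** By the double-angle formula [cos t = 1] would force [sin (|t| / 2) = 0], although [|t| / 2] lies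
    strictly between 0 and [pi]. *)
Lemma expi_neq1 (t : R) : 0 < `|t| < 2 * pi -> expi t != 1.
Proof.
move=> t2pi; rewrite eq_complex/= negb_and; apply/orP; left.
have -> : cos t = cos (`|t| / 2 *+ 2).
  by rewrite -mulr_natr divfK//; case: ger0P; rewrite ?cosN.
rewrite cos_mulr2n; apply/eqP => cos1.
have : 0 < sin (`|t| / 2).
  apply: sin_gt0_pi; rewrite divr_gt0//=; last by case/andP: t2pi.
  by rewrite ltr_pdivrMr// mulrC; case/andP: t2pi.
have := cos2Dsin2 (`|t| / 2); have -> : cos (`|t| / 2) ^+ 2 = 1 by lra.
move/eqP; rewrite -subr_eq0 addrAC subrr add0r sqrf_eq0 => /eqP ->.
by rewrite ltxx.
Qed.

(** The added phase is linear in [h]: its slope yields the derivative, and its value at [h = L] the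
    periodicity. *)
Lemma Lambda_basis k x a (h : R) : Lambda L k (h *: e_ a + x) =
  expi (h * (2 * pi * (k 0 a)%:~R / L)
    + 2 * pi * (\sum_(b < 3) (k 0 b)%:~R * x 0 b) / L).
Proof.
rewrite /Lambda; congr (expi _).
under eq_bigr do rewrite !mxE mulrDr.
rewrite big_split/= (bigD1 a)//= big1 => [|b ba]; last first.
  by rewrite ?eqxx (negPf ba) !mulr0.
by rewrite ?eqxx ?mulr1 addr0 mulrDr mulrDl; congr (_ + _); ring.
Qed.

Lemma partial_Lambda k a : has_partial a (Lambda L k) /\
  partial a (Lambda L k) = symbol k a *: Lambda L k.
Proof.
pose w := 2 * pi * (k 0 a)%:~R / L.
pose p x := 2 * pi * (\sum_(b < 3) (k 0 b)%:~R * x 0 b) / L.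
have lin x : is_derive (0 : R) 1 (fun h : R => h * w + p x) w.
  rewrite (_ : (fun h => _) = w *: (@id R) + cst (p x)); last first.
    by apply/funext => h; rewrite /= mulrC.
  by apply: is_derive_eq; rewrite addr0 [w *: 1]mulr1.
have dre x : is_derive x (e_ a)
    (fun y => complex.Re (Lambda L k y)) (- sin (p x) * w).
  apply: derive_line.
  rewrite (_ : (fun h => _) = cos \o (fun h : R => h * w + p x)); last first.
    by apply/funext => h; rewrite Lambda_basis.
  by apply: is_derive1_comp; rewrite mul0r add0r; exact: is_derive_cos.
have dim x : is_derive x (e_ a)
    (fun y => complex.Im (Lambda L k y)) (cos (p x) * w).
  apply: derive_line.
  rewrite (_ : (fun h => _) = sin \o (fun h : R => h * w + p x)); last first.
    by apply/funext => h; rewrite Lambda_basis.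
  by apply: is_derive1_comp; rewrite mul0r add0r; exact: is_derive_sin.
split=> [x|].
  by split; [exact: (@ex_derive _ _ _ _ _ _ _ (dre x))
            | exact: (@ex_derive _ _ _ _ _ _ _ (dim x))].
apply/funext => x; rewrite /partial.
rewrite (@derive_val _ _ _ _ _ _ _ (dre x)) (@derive_val _ _ _ _ _ _ _ (dim x)).
rewrite -[RHS]/(symbol k a * Lambda L k x) /symbol /Lambda -/w -/(p x).
by rewrite /expi; simpc; congr (_ +i* _); rewrite mulrC.
Qed.

Lemma C0per_Lambda k : C0per L (Lambda L k).
Proof.
split.
  apply/continuous_ReIm.
  have cq b x : (fun y : point => y 0 b) @ x --> x 0 b.
    exact: coord_continuous.
  have cp : continuous (fun x : point =>
      2 * pi * (\sum_(b < 3) (k 0 b)%:~R * x 0 b) / L : R).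
    have -> : (fun x : point =>
        2 * pi * (\sum_(b < 3) (k 0 b)%:~R * x 0 b) / L : R) =
        (fun x => 2 * pi * ((k 0 0)%:~R * x 0 0 + (k 0 1)%:~R * x 0 1
          + (k 0 2)%:~R * x 0 2) / L) by apply/funext => x; rewrite sum3.
    move=> x; exact: (cvgMr_tmp (cvgMl_tmp (cvgD (cvgD (cvgMl_tmp (cq 0 x))
      (cvgMl_tmp (cq 1 x))) (cvgMl_tmp (cq 2 x))))).
  split=> x; apply: (cvg_comp _ _ (cp x)); first exact: continuous_cos.
  exact: continuous_sin.
move=> x a; rewrite addrC Lambda_basis /Lambda expiD.
rewrite [X in expi X](_ : _ = 2 * pi * (k 0 a)%:~R) ?expi_2pi ?mul1r//.
by rewrite mulrC divfK ?gt_eqF.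
Qed.

Local Notation char m := (fun t : R => expi (2 * pi * (m%:~R * t) / L)).

(** Seeing a univariate character as the restriction of a mode to an axis makes the three-variable
    facts on continuity and means available for it. *)
Lemma charE (m : int) t : Lambda L (const_mx m) (set_coord 0 0 t) = char m t.
Proof. by rewrite /Lambda sum3 !mxE/= !(mulr0, addr0, add0r) subr0 mulr1. Qed.

Lemma continuous_char (m : int) : continuous (char m : R -> C^o).
Proof.
under eq_fun do rewrite -charE.
by apply: continuous_along; case: (C0per_Lambda (const_mx m)).
Qed.

(** For [d != 0] the terms are powers of an [M]-th root of unity [z], and [|d| < M] ensures
    [z != 1]. Multiplied by [z - 1], the sum from 1 to [M] telescopes to [z * (z ^+ M - 1) = 0]. *)
Lemma sum_expi_roots (d : int) : (`|d| < M)%N ->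
  \sum_(1 <= i < M.+1) expi (i%:R * (2 * pi * d%:~R / M%:R)) =
    M%:R * (d == 0)%:R :> C.
Proof.
move=> dM; have M0 : 0 < M%:R :> R by rewrite ltr0n.
have [->|d0] := eqVneq d 0.
  rewrite mulr1; under eq_bigr do rewrite mulr0z mulr0 mul0r mulr0 expi0.
  by rewrite sumr_const_nat subn1.
rewrite mulr0; under eq_bigr do rewrite -expiX.
set z := expi _.
have zM : z ^+ M = 1 by rewrite expiX mulrC divfK ?gt_eqF// expi_2pi.
have z1 : z != 1.
  apply: expi_neq1; rewrite normr_gt0.
  rewrite !mulf_neq0 ?invr_neq0 ?intr_eq0 ?d0 ?lt0r_neq0 ?pi_gt0//=.
  rewrite !normrM normfV (gtr0_norm M0) (gtr0_norm (pi_gt0 R)) ger0_norm//.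
  by rewrite ltr_pdivrMr// ltr_pM2l ?mulr_gt0 ?pi_gt0// -intr_norm ltr_nat.
have z10 : z - 1 != 0 by rewrite subr_eq0.
apply: (mulfI z10); rewrite mulr0 big_add1/= big_mkord.
under eq_bigr do rewrite exprS.
by rewrite -mulr_sumr mulrCA -subrX1 zM subrr mulr0.
Qed.

Lemma dft1Z n (c : C) (f : R -> C) : continuous (f : R -> C^o) ->
  dft1 L M n (fun t => c * f t) = c * dft1 L M n f.
Proof.
move=> cf; have c0 : continuous ((fun=> 0) : R -> C^o) by exact: cst_continuous.
have z0 : dft1 L M n (fun=> 0) = 0.
  have := dft1_linear L M n (-1) _ _ c0 c0.
  by under eq_fun do rewrite mulr0 addr0; rewrite mulN1r addNr.
have := dft1_linear L M n c _ _ cf c0.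
by under eq_fun do rewrite addr0; rewrite z0 addr0.
Qed.

Lemma dft1_char (m n : int) : (`|m - n| < M)%N ->
  dft1 L M n (char m) = (m == n)%:R.
Proof.
move=> mnM; have [n0|n0] := eqVneq n 0.
  have [m0|m0] := eqVneq m 0.
    have -> : char m = (fun=> 1).
      by apply/funext => t; rewrite m0 mul0r mulr0 mul0r expi0.
    rewrite n0 m0 /dft1 eqxx /=.
    rewrite !Rintegral_period_cst// mul1r mul0r -[_ +i* _]/(L%:C).
    by rewrite -rmorphM mulVf ?gt_eqF.
  (* For [m != 0] the character is, up to the nonzero factor [symbol], the derivative of a periodic
     function, so its mean vanishes without computing an integral. *)
  have cL := C0per_Lambda (const_mx m).
  have [dL eL] := partial_Lambda (const_mx m) 0.
  have cdL : continuous (partial 0 (Lambda L (const_mx m)) : point -> C^o).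
    rewrite eL => x; exact: (cvgMl_tmp (cL.1 x)).
  have := congr1 (fun G => G 0) (axis_dft0_partial L M L_gt0 0 _ cL dL cdL).
  rewrite eL /axis_dft (_ : (fun t => _) =
    fun t => symbol (const_mx m) 0 * char m t); last first.
    by apply/funext => t; rewrite -charE.
  rewrite dft1Z; last exact: continuous_char.
  move=> /eqP; rewrite mulf_eq0 (negPf (symbol_neq0 _ _ _)) ?mxE//= n0.
  move=> /eqP ->.
  by rewrite (negPf m0).
rewrite /dft1 (negPf n0).
rewrite (eq_bigr (fun i => expi (i%:R * (2 * pi * (m - n)%:~R / M%:R)))).
  by rewrite sum_expi_roots// mulKf ?pnatr_eq0 -?lt0n// subr_eq0.
move=> i _; rewrite -expiD; congr expi; rewrite intrB; field.
by rewrite pnatr_eq0 -lt0n M_gt0 gt_eqF.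
Qed.

Lemma dftZ k (c : C) G : C0per L G -> dft L M k (c *: G) = c * dft L M k G.
Proof.
move=> cG; have c0 : C0per L 0.
  by split=> //; exact: cst_continuous.
have z0 : dft L M k 0 = 0.
  have := dft_linear k (-1) _ _ c0 c0.
  by rewrite scaler0 addr0 mulN1r addNr.
by rewrite -[c *: G]addr0 dft_linear// z0 addr0.
Qed.

(** A mode is a product of three characters; evaluated from the innermost axis outwards, each
    contributes one Kronecker delta. *)
Lemma dft_Lambda j k : (forall a, (`|(j 0 a - k 0 a)%R| < M)%N) ->
  dft L M k (Lambda L j) = (j == k)%:R.
Proof.
move=> jkM; rewrite /dft.
have e t1 t2 t3 : Lambda L j (mkpoint t1 t2 t3) =
    char (j 0 0) t1 * (char (j 0 1) t2 * char (j 0 2) t3).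
  rewrite /Lambda sum3 !mxE !(tnth_nth 0)/= -!expiD; congr expi; ring.
have e3 t1 t2 : dft1 L M (k 0 2) (fun t3 => Lambda L j (mkpoint t1 t2 t3)) =
    char (j 0 0) t1 * (char (j 0 1) t2 * (j 0 2 == k 0 2)%:R).
  under eq_fun do rewrite e mulrA.
  by rewrite dft1Z ?dft1_char ?mulrA//; exact: continuous_char.
have e2 t1 : dft1 L M (k 0 1) (fun t2 => dft1 L M (k 0 2) (fun t3 =>
      Lambda L j (mkpoint t1 t2 t3))) =
    char (j 0 0) t1 * ((j 0 1 == k 0 1)%:R * (j 0 2 == k 0 2)%:R).
  rewrite (_ : (fun t2 => _) = fun t2 => char (j 0 0) t1 * (j 0 2 == k 0 2)%:R *
      char (j 0 1) t2); last by apply/funext => t2; rewrite e3; ring.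
  by rewrite dft1Z ?dft1_char//; [ring | exact: continuous_char].
under eq_fun do rewrite e2 mulrC.
rewrite dft1Z; last exact: continuous_char.
rewrite dft1_char// -!natrM !mulnb; congr ((nat_of_bool _)%:R).
apply/idP/eqP => [|->]; last by rewrite !eqxx.
move=> /andP[/andP[/eqP e1 /eqP e2'] /eqP e0].
by apply/rowP; apply: ord3_ind.
Qed.

End FourierModes.

(** * Trigonometric polynomials and the common form of the operators *)

Section SpectralOperators.
Context {R : realType} (L : R) (K M : nat) (gamma : 'rV[int]_3 -> R[i]).
Hypotheses (L_gt0 : 0 < L) (KM : (2 * K + 1 <= M)%N).
Local Notation C := R[i].
Local Notation point := 'rV[R]_3.
Local Notation sfield := (point -> C).
Implicit Types (a b : 'I_3) (s t : seq 'I_3) (j k : 'rV[int]_3).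
Implicit Types (G u v : sfield).

Let M_gt0 : (0 < M)%N. Proof. lia. Qed.

Lemma uniq_modes : uniq (modes K).
Proof.
rewrite map_inj_uniq ?enum_uniq// => j k /rowP jk; apply/rowP => a.
by have := jk a; rewrite !mxE => /addIr[] /val_inj.
Qed.

Lemma modes_bound k a : k \in modes K -> (`|(k 0 a)%R| <= K)%N.
Proof.
move=> /mapP[r _ ->]; rewrite mxE /=; case: (r 0 a) => i /= iK; lia.
Qed.

Lemma trigpolyE (c : 'rV[int]_3 -> C) :
  trigpoly L K c = \sum_(k <- modes K) c k *: Lambda L k.
Proof. by apply/funext => x; rewrite fct_sumE. Qed.

Lemma partials_Lambda t k :
  partials t (Lambda L k) = (\prod_(a <- t) symbol L k a) *: Lambda L k
  /\ forall a, has_partial a (partials t (Lambda L k)).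
Proof.
have dZ (c : C) a : has_partial a (c *: Lambda L k) /\
    partial a (c *: Lambda L k) = (symbol L k a * c) *: Lambda L k.
  have [dL eL] := partial_Lambda L k a.
  have [d0 _] := has_partial_linear a (-1) _ _ dL dL.
  (* Writing 0 as a combination of modes makes the rule for scalar multiples an instance of
     [has_partial_linear]. *)
  have z0 : -1 *: Lambda L k + Lambda L k = 0 by rewrite scaleN1r addNr.
  have [_ e0] := has_partial_linear a (-1) _ _ dL dL.
  rewrite z0 in d0 e0.
  have [] := has_partial_linear a c _ _ dL d0.
  by rewrite e0 eL scaleN1r addNr !addr0 scalerA mulrC.
elim: t => [|b t [e IH]].
  by rewrite big_nil scale1r; split=> // a; case: (partial_Lambda L k a).
rewrite /= e (dZ _ b).2 big_cons; split; first by [].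
by move=> a; exact: (dZ _ a).1.
Qed.

Lemma C1per_Lambda s k : C1per L s (Lambda L k).
Proof.
split=> [a t _|t _]; first exact: (partials_Lambda t k).2.
rewrite (partials_Lambda t k).1 -[_ *: _]addr0.
have -> : 0 = -1 *: Lambda L k + Lambda L k by rewrite scaleN1r addNr.
by do 2?apply: C0per_linear; exact: C0per_Lambda.
Qed.

Lemma C1per0 s : C1per L s 0.
Proof.
have -> : 0 = -1 *: Lambda L 0 + Lambda L 0 by rewrite scaleN1r addNr.
by apply: C1per_linear; exact: C1per_Lambda.
Qed.

Lemma C1per_modes s (r : seq 'rV[int]_3) (c : 'rV[int]_3 -> C) :
  C1per L s (\sum_(k <- r) c k *: Lambda L k).
Proof.
elim: r => [|k r IH]; first by rewrite big_nil; exact: C1per0.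
by rewrite big_cons; apply: C1per_linear => //; exact: C1per_Lambda.
Qed.

Lemma C1per_trigpoly s (c : 'rV[int]_3 -> C) : C1per L s (trigpoly L K c).
Proof. by rewrite trigpolyE; exact: C1per_modes. Qed.

Lemma partial_trigpoly a (c : 'rV[int]_3 -> C) :
  partial a (trigpoly L K c) = trigpoly L K (fun k => symbol L k a * c k).
Proof.
rewrite !trigpolyE; elim: (modes K) => [|k r IH].
  have := partials_linear L [:: a] (-1) _ _ [:: a]
    (C1per0 _) (C1per0 _) (subseq_refl _).
  by rewrite !big_nil scaler0 addr0 scaleN1r addNr.
have d := (C1per_modes [:: a] r c).1 a [::] (subseq_refl _).
have [dL eL] := partial_Lambda L k a.
rewrite !big_cons (has_partial_linear a (c k) _ _ dL d).2 IH eL.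
by rewrite scalerA mulrC.
Qed.

(** The surviving axes form a subsequence of [s], so the pseudo-derivatives are exactly among the
    derivatives controlled by [C1per s]. *)
Lemma foldr_DtildeE k s G :
  foldr (Dtilde k) G s = partials [seq a <- s | k 0 a != 0] G.
Proof.
elim: s => //= a s ->; rewrite /Dtilde; by case: eqP.
Qed.

(** The spectral coefficient before filtering and before division by the [Dhat] factors. *)
Definition sampled k s G : C := dft L M k (foldr (Dtilde k) G s).

Lemma sampled_linear k s (c : C) u v : C1per L s u -> C1per L s v ->
  sampled k s (c *: u + v) = c * sampled k s u + sampled k s v.
Proof.
move=> cu cv; have fs := filter_subseq (fun a => k 0 a != 0) s.
rewrite /sampled !foldr_DtildeE (partials_linear L s)//.
by apply: dft_linear => //; [exact: cu.2 | exact: cv.2].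
Qed.

(** Two modes differ by at most [2 * K < M] along each axis, so only the term [k] survives. Its
    derivatives produce the symbols of the axes of nonzero frequency, and on the other axes [Dhat]
    is 1. *)
Lemma sampled_trigpoly s k (c : 'rV[int]_3 -> C) : k \in modes K ->
  sampled k s (trigpoly L K c) = c k * \prod_(a <- s) Dhat L k a.
Proof.
move=> kK; have sL j : j \in modes K -> sampled k s (Lambda L j) =
    (j == k)%:R * \prod_(a <- s) Dhat L k a.
  move=> jK; have cL := C0per_Lambda L L_gt0 j.
  rewrite /sampled foldr_DtildeE (partials_Lambda _ j).1 dftZ// dft_Lambda//.
    have [->|_] := eqVneq j k; last by rewrite mulr0 mul0r.
    rewrite mulr1 mul1r big_filter big_mkcond; apply: eq_bigr => a _.
    by rewrite /Dhat if_neg.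
  move=> a; have := modes_bound _ a jK; have := modes_bound _ a kK; lia.
rewrite trigpolyE.
have -> : sampled k s (\sum_(j <- modes K) c j *: Lambda L j) =
    \sum_(j <- modes K) c j * sampled k s (Lambda L j).
  elim: (modes K) => [|j r IH].
    rewrite !big_nil; have := sampled_linear k s (-1) _ _ (C1per0 s) (C1per0 s).
    by rewrite scaler0 addr0 mulN1r addNr.
  rewrite !big_cons sampled_linear ?IH//.
    exact: C1per_Lambda.
  exact: C1per_modes.
rewrite (bigD1_seq k)//=; last exact: uniq_modes.
rewrite big1_seq; last first.
  move=> j /andP[jk jK]; rewrite sL// (negPf jk) mul0r mulr0 //.
by rewrite sL// eqxx mul1r addr0.
Qed.

(* The common form of the four operators: [s] lists the 3 - l axes along which
   (each component of) Pi^l differentiates. *)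
Definition pseudo_dft s G : sfield := trigpoly L K
  (fun k => gamma k * (\prod_(a <- s) Dhat L k a)^-1 * sampled k s G).

Lemma trigpoly_linear (z : C) (c d : 'rV[int]_3 -> C) :
  trigpoly L K (fun k => z * c k + d k) = z *: trigpoly L K c + trigpoly L K d.
Proof.
rewrite !trigpolyE scaler_sumr -big_split /=; apply: eq_bigr => k _.
by rewrite scalerDl scalerA.
Qed.

Lemma eq_trigpoly (c d : 'rV[int]_3 -> C) : {in modes K, c =1 d} ->
  trigpoly L K c = trigpoly L K d.
Proof.
by move=> cd; rewrite !trigpolyE; apply: eq_big_seq => k /cd ->.
Qed.

Lemma pseudo_dft_linear s (c : C) u v : C1per L s u -> C1per L s v ->
  pseudo_dft s (c *: u + v) = c *: pseudo_dft s u + pseudo_dft s v.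
Proof.
move=> cu cv; rewrite /pseudo_dft -trigpoly_linear; congr (trigpoly L K _).
by apply/funext => k; rewrite sampled_linear//; ring.
Qed.

Lemma pseudo_dft_perm s t G : uniq s -> perm_eq s t -> C1per L s G ->
  pseudo_dft s G = pseudo_dft t G.
Proof.
move=> us st cG; congr (trigpoly L K _); apply/funext => k.
rewrite (perm_big _ st)/=; congr (_ * dft L M k _).
rewrite !foldr_DtildeE; apply: (partials_perm L s) => //.
- exact: filter_uniq.
- by move=> a; rewrite mem_filter => /andP[].
- exact: perm_filter.
Qed.

(** All three commutation relations rest on this identity. On coefficients the derivative multiplies
    by [symbol k a], and [dft_partial] absorbs this factor together with the inverse of [Dhat] and
    the pseudo-derivative along [a]. *)
Lemma partial_pseudo_dft a s G : uniq (a :: s) -> C1per L (a :: s) G ->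
  partial a (pseudo_dft (a :: s) G) = pseudo_dft s (partial a G).
Proof.
move=> uas cG; rewrite partial_trigpoly.
congr (trigpoly L K _); apply/funext => k.
pose s' := [seq b <- s | k 0 b != 0].
have s's : subseq s' s by exact: filter_subseq.
have as' : subseq (a :: s') (a :: s) by rewrite /= eqxx.
(* The right-hand operator differentiates along [a] first, while [dft_partial] needs this derivative
   outermost. *)
have e : foldr (Dtilde k) (partial a G) s = partial a (foldr (Dtilde k) G s).
  rewrite !foldr_DtildeE -/s'.
  have -> : partials s' (partial a G) = partials (rcons s' a) G.
    by rewrite /partials foldr_rcons.
  rewrite -[RHS]/(partials (a :: s') G).
  apply: (partials_perm L (a :: s)) => //.
  - by rewrite rcons_uniq -[_ && _]/(uniq (a :: s')); exact: subseq_uniq uas.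
  - by move=> b; rewrite mem_rcons => /(mem_subseq as').
  - by rewrite perm_rcons.
have ca : C1per L [:: a] (foldr (Dtilde k) G s).
  apply/C1per_seq1; rewrite foldr_DtildeE; split.
  - by apply: cG.2; exact: subseq_trans (subseq_cons _ _) as'.
  - exact: cG.1.
  - exact: (cG.2 (a :: s')).
rewrite /sampled e dft_partial// big_cons invfM /=.
by ring.
Qed.

(** The sampled coefficients are the original ones times the [Dhat] factors, which never vanish and
    are divided out again. *)
Lemma pseudo_dft_id s : (forall k, k \in modes K -> gamma k = 1) ->
  forall G, VKs L K G -> pseudo_dft s G = G.
Proof.
move=> g1 _ [c ->]; apply: eq_trigpoly => k kK.
rewrite g1// mul1r sampled_trigpoly// mulrCA mulVf ?mulr1//.
rewrite prodf_seq_neq0; apply/allP => a _ /=; rewrite /Dhat.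
by have [_|ka] := eqVneq (k 0 a) 0; [exact: oner_neq0 | exact: symbol_neq0].
Qed.

End SpectralOperators.

(** * The domains in circular indexing *)

Section Domains.
Context {R : realType} (L : R).
Local Notation sfield := ('rV[R]_3 -> R[i]).
Implicit Types (a : 'I_3) (F : 'I_3 -> sfield).

Lemma C1per_swap (a b : 'I_3) (G : sfield) : a != b ->
  C1per L [:: a; b] G -> C1per L [:: b; a] G.
Proof.
move=> ab; apply: C1per_subset; rewrite /= ?inE ?ab// 1?eq_sym ?ab//.
by move=> c; rewrite !inE orbC.
Qed.

(** Only component 1 needs work: its circular list is [[:: 2; 0]], against [[:: 0; 2]] in [V1]. *)
Lemma V1E F : V1 L F <-> forall a, C1per L [:: a + 1; a + 2] (F a).
Proof.
have e0 : [:: 0 + 1; 0 + 2] = [:: 1; 2] :> seq 'I_3.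
  by congr [:: _; _]; apply/val_inj.
have e1 : [:: 1 + 1; 1 + 2] = [:: 2; 0] :> seq 'I_3.
  by congr [:: _; _]; apply/val_inj.
have e2 : [:: 2 + 1; 2 + 2] = [:: 0; 1] :> seq 'I_3.
  by congr [:: _; _]; apply/val_inj.
split=> [[F0 F1 F2]|FP]; last first.
  split; first by rewrite -e0.
    by apply: C1per_swap => //; rewrite -e1.
  by rewrite -e2.
by apply: ord3_ind; rewrite ?e0 ?e1 ?e2//; exact: C1per_swap.
Qed.

Lemma V2E F : V2 L F <-> forall a, C1per L [:: a] (F a).
Proof. by split=> [[F0 F1 F2]|FP]; [exact: ord3_ind | split]. Qed.

End Domains.

(** * The commuting diagram and the projection property *)

Section CommutingDiagram.
Context {R : realType} (L : R) (K M : nat) (gamma : 'rV[int]_3 -> R[i]).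
Hypotheses (L_gt0 : 0 < L) (KM : (2 * K + 1 <= M)%N).
Local Notation sfield := ('rV[R]_3 -> R[i]).
Local Notation P := (pseudo_dft L K M gamma).

Lemma Pi3E G : Pi3 L K M gamma G = P [::] G.
Proof.
by congr (trigpoly L K _); apply/funext => k; rewrite big_nil invr1 mulr1.
Qed.

Lemma Pi2E F a : Pi2 L K M gamma F a = P [:: a] (F a).
Proof.
by congr (trigpoly L K _); apply/funext => k; rewrite big_seq1.
Qed.

Lemma Pi1E F a : Pi1 L K M gamma F a = P [:: a + 1; a + 2] (F a).
Proof.
by congr (trigpoly L K _); apply/funext => k; rewrite big_cons big_seq1.
Qed.

Lemma Pi0E G : Pi0 L K M gamma G = P [:: 0; 1; 2] G.
Proof.
congr (trigpoly L K _); apply/funext => k.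
by rewrite !big_cons big_nil mulr1 mulrA.
Qed.

Lemma uniq_axes (a : 'I_3) : uniq [:: a; a + 1; a + 2].
Proof. by move: a; apply: ord3_ind. Qed.

Lemma axes_perm (a : 'I_3) : perm_eq [:: 0; 1; 2] [:: a; a + 1; a + 2].
Proof. by move: a; apply: ord3_ind. Qed.

Lemma addI3 (a : 'I_3) : [/\ a + 1 + 1 = a + 2, a + 1 + 2 = a,
  a + 2 + 1 = a & a + 2 + 2 = a + 1].
Proof. by move: a; apply: ord3_ind; split; apply/val_inj. Qed.

(** For component [a] the three axes are permuted to put [a] in front; the gradient removes it and
    leaves [a + 1] and [a + 2], the axes of [Pi1]. *)
Lemma grad_Pi0 (G : sfield) : V0 L G ->
  V1 L (grad G) /\ grad (Pi0 L K M gamma G) = Pi1 L K M gamma (grad G).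
Proof.
move=> cG; have cGa a : C1per L [:: a; a + 1; a + 2] G.
  apply: C1per_subset cG => //; first exact: uniq_axes.
  by move=> b; rewrite (perm_mem (axes_perm a)).
split; first by apply/V1E => a; apply: C1per_partial (uniq_axes a) (cGa a).
apply/funext => a; rewrite Pi1E /grad Pi0E.
rewrite (pseudo_dft_perm _ _ _ _ [:: 0; 1; 2] [:: a; a + 1; a + 2])//.
  by rewrite partial_pseudo_dft//; exact: uniq_axes.
exact: axes_perm.
Qed.

Lemma pseudo_dftB (s : seq 'I_3) (u v : sfield) :
  C1per L s u -> C1per L s v ->
  C1per L s (u - v) /\ P s (u - v) = P s u - P s v.
Proof.
move=> cu cv; have -> : u - v = -1 *: v + u by rewrite scaleN1r addrC.
split; first exact: C1per_linear.
rewrite (pseudo_dft_linear L K M gamma L_gt0 KM s (-1) v u cv cu) scaleN1r.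
exact: addrC.
Qed.

(** In component [a] of the curl, [G (a + 1)] carries the axes [a + 2] and [a], and [G (a + 2)] the
    axes [a] and [a + 1]. The derivative taken in each term leaves just [a], the axis of [Pi2]. *)
Lemma curl_Pi1 (G : 'I_3 -> sfield) : V1 L G ->
  V2 L (curl G) /\ curl (Pi1 L K M gamma G) = Pi2 L K M gamma (curl G).
Proof.
move=> /V1E cG.
have cG1 (a : 'I_3) : C1per L [:: a + 2; a] (G (a + 1)).
  by have := cG (a + 1); case: (addI3 a) => -> -> _ _.
have cG2 (a : 'I_3) : C1per L [:: a + 1; a] (G (a + 2)).
  apply: C1per_swap; last by have := cG (a + 2); case: (addI3 a) => _ _ -> ->.
  by move: a; apply: ord3_ind.
have u1 (a : 'I_3) : uniq [:: a + 2; a] by move: a; apply: ord3_ind.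
have u2 (a : 'I_3) : uniq [:: a + 1; a] by move: a; apply: ord3_ind.
have c1 (a : 'I_3) : C1per L [:: a] (partial (a + 2) (G (a + 1))).
  exact: C1per_partial.
have c2 (a : 'I_3) : C1per L [:: a] (partial (a + 1) (G (a + 2))).
  exact: C1per_partial.
split; first by apply/V2E => a; exact: (pseudo_dftB _ _ _ (c2 a) (c1 a)).1.
apply/funext => a; rewrite Pi2E /curl !Pi1E.
have e1 : partial (a + 2) (P [:: a + 2; a] (G (a + 1))) =
    P [:: a] (partial (a + 2) (G (a + 1))) by exact: partial_pseudo_dft.
have e2 : partial (a + 1) (P [:: a + 1; a] (G (a + 2))) =
    P [:: a] (partial (a + 1) (G (a + 2))) by exact: partial_pseudo_dft.
(* Only this term has the axis to be removed in second place. *)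
have e3 : P [:: a; a + 1] (G (a + 2)) = P [:: a + 1; a] (G (a + 2)).
  apply: esym; apply: pseudo_dft_perm => //.
  by apply/permP => p /=; rewrite addnCA.
rewrite (pseudo_dftB _ _ _ (c2 a) (c1 a)).2.
case: (addI3 a) => -> -> -> ->; rewrite e3 e2 e1; reflexivity.
Qed.

(** Each derivative removes the only axis of its component, so all terms carry the same operator and
    linearity adds them up. *)
Lemma div_Pi2 (G : 'I_3 -> sfield) : V2 L G ->
  V3 L (div G) /\ div (Pi2 L K M gamma G) = Pi3 L K M gamma (div G).
Proof.
move=> /V2E cG.
have c a : C1per L [::] (partial a (G a)) by exact: C1per_partial.
rewrite /div Pi3E !sum3 !Pi2E.
have add u v : C1per L [::] u -> C1per L [::] v ->
    C1per L [::] (u + v) /\ P [::] (u + v) = P [::] u + P [::] v.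
  move=> cu cv; rewrite -[u]scale1r; split; first exact: C1per_linear.
  by rewrite pseudo_dft_linear// !scale1r.
have [c01 e01] := add _ _ (c 0) (c 1); have [c012 e012] := add _ _ c01 (c 2).
split; first exact/C1per_nil.
have ex a : partial a (P [:: a] (G a)) = P [::] (partial a (G a)).
  exact: partial_pseudo_dft.
rewrite !ex e012 e01; reflexivity.
Qed.

Hypothesis gamma1 : forall k, k \in modes K -> gamma k = 1.

Lemma pseudo_dft_fix s c : P s (trigpoly L K c) = trigpoly L K c.
Proof. by apply: pseudo_dft_id => //; exists c. Qed.

(** Every value of [P s] is a trigonometric polynomial by construction, and these are fixed by
    [P s]; idempotence and the range both follow. *)
Lemma projection_scalar s : projection_onto (C1per L s) (VKs L K) (P s).
Proof.
split.
- by move=> _ [c ->]; exact: C1per_trigpoly.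
- move=> c u v cu cv; split; [exact: C1per_linear | exact: pseudo_dft_linear].
- by move=> u _; rewrite {2}/pseudo_dft pseudo_dft_fix.
- apply/seteqP; split=> [_ [u _ <-]|_ [c ->]]; first by eexists.
  by exists (trigpoly L K c); [exact: C1per_trigpoly | exact: pseudo_dft_fix].
Qed.

Lemma projection_vector (s : 'I_3 -> seq 'I_3) :
  projection_onto [set F : 'I_3 -> sfield | forall a, C1per L (s a) (F a)]
    (VKv L K) (fun F a => P (s a) (F a)).
Proof.
split.
- by move=> _ [c ->] a; exact: C1per_trigpoly.
- move=> c u v cu cv; split=> [a|]; first exact: C1per_linear.
  by apply/funext => a; exact: pseudo_dft_linear.
- by move=> u _; apply/funext => a; rewrite {2}/pseudo_dft pseudo_dft_fix.
- apply/seteqP; split=> [_ [u _ <-]|_ [c ->]]; first by eexists.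
  exists (fun a => trigpoly L K (c a)).
    by move=> a; exact: C1per_trigpoly.
  by apply/funext => a; exact: pseudo_dft_fix.
Qed.

End CommutingDiagram.

Theorem lemma2 (R : realType) (L : R) (K M : nat)
    (gamma : 'rV[int]_3 -> R[i])
    (hL : 0 < L) (hM : (2 * K + 1 <= M)%N)
    (hgamma : forall k, k \in modes K -> gamma k = (gamma (- k))^*) :
  [/\ forall G : 'rV[R]_3 -> R[i], V0 L G ->
        V1 L (grad G) /\
        grad (Pi0 L K M gamma G) = Pi1 L K M gamma (grad G),
      forall G : 'I_3 -> 'rV[R]_3 -> R[i], V1 L G ->
        V2 L (curl G) /\
        curl (Pi1 L K M gamma G) = Pi2 L K M gamma (curl G)
    & forall G : 'I_3 -> 'rV[R]_3 -> R[i], V2 L G ->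
        V3 L (div G) /\
        div (Pi2 L K M gamma G) = Pi3 L K M gamma (div G)] /\
  ((forall k, k \in modes K -> gamma k = 1) ->
   [/\ projection_onto (V0 L) (VKs L K) (Pi0 L K M gamma),
       projection_onto (V1 L) (VKv L K) (Pi1 L K M gamma),
       projection_onto (V2 L) (VKv L K) (Pi2 L K M gamma)
     & projection_onto (V3 L) (VKs L K) (Pi3 L K M gamma)]).
Proof.
split=> [|gamma1].
  split=> G; [exact: grad_Pi0 | exact: curl_Pi1 | exact: div_Pi2].
split.
- rewrite (_ : Pi0 L K M gamma = pseudo_dft L K M gamma [:: 0; 1; 2]).
    exact: projection_scalar.
  by apply/funext => G; exact: Pi0E.
- rewrite (_ : Pi1 L K M gamma =
    fun F a => pseudo_dft L K M gamma [:: a + 1; a + 2] (F a)); last first.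
    by apply/funext => F; apply/funext => a; exact: Pi1E.
  rewrite (_ : V1 L = [set F | forall a, C1per L [:: a + 1; a + 2] (F a)]).
    exact: projection_vector.
  by apply/seteqP; split=> F /V1E.
- rewrite (_ : Pi2 L K M gamma =
    fun F a => pseudo_dft L K M gamma [:: a] (F a)).
    rewrite (_ : V2 L = [set F | forall a, C1per L [:: a] (F a)]).
      exact: projection_vector.
    by apply/seteqP; split=> F /V2E.
  by apply/funext => F; apply/funext => a; exact: Pi2E.
- rewrite (_ : Pi3 L K M gamma = pseudo_dft L K M gamma [::]).
    rewrite (_ : V3 L = C1per L [::]); first exact: projection_scalar.
    by apply/seteqP; split=> G /C1per_nil.
  by apply/funext => G; exact: Pi3E.
Qed.
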